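(* Let $n\ge 1$ and let $\mu,\nu,\lambda\in{\sf Par}_n$. Then the Newell-Littlewood number $N_{\mu,\nu,\lambda}$ equals the number of lattice points of the Newell-Littlewood polytope: $N_{\mu,\nu,\lambda}=\#\big({\mathcal P}_{\mu,\nu,\lambda}\cap{\mathbb Z}^{3n^2}\big)$.
   Context: ${\sf Par}_n=\{(\lambda_1,\ldots,\lambda_n)\in{\mathbb Z}_{\ge0}^n:\lambda_1\ge\cdots\ge\lambda_n\}$ is the set of partitions with at most $n$ nonzero parts. With $c_{\alpha,\beta}^{\mu}$ the Littlewood-Richardson coefficient ($s_\alpha s_\beta=\sum_\mu c_{\alpha,\beta}^\mu s_\mu$), the Newell-Littlewood number is $$N_{\mu,\nu,\lambda}=\sum_{\alpha,\beta,\gamma} c_{\alpha,\beta}^{\mu}c_{\alpha,\gamma}^{\nu}c_{\beta,\gamma}^{\lambda},$$ the sum over all triples of partitions (finitely many nonzero terms). The Newell-Littlewood polytope ${\mathcal P}_{\mu,\nu,\lambda}\subset{\mathbb R}^{3n^2}$ is the set of all real vectors $(\alpha_i^j,\beta_i^j,\gamma_i^j)_{1\le i,j\le n}$ satisfying the following linear constraints (all summation indices range over $1,\ldots,n$ subject to the displayed restriction; $k,l$ range over $1,\ldots,n$; any variable with an index outside $1,\ldots,n$ is read as $0$): (1) Non-negativity: $\alpha_i^j,\beta_i^j,\gamma_i^j\ge 0$ for all $1\le i,j\le n$. (2) Shape constraints, for all $k$: (a) $\sum_j\alpha_k^j+\sum_i\beta_i^k=\mu_k$; (b) $\sum_j\gamma_k^j+\sum_i\alpha_i^k=\nu_k$;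 (c) $\sum_j\beta_k^j+\sum_i\gamma_i^k=\lambda_k$. (3) Semistandardness constraints, for all $k,l$: (a) $\sum_j\alpha_{k+1}^j+\sum_{i\le l}\beta_i^{k+1}\le\sum_j\alpha_k^j+\sum_{i<l}\beta_i^k$; (b) $\sum_j\gamma_{k+1}^j+\sum_{i\le l}\alpha_i^{k+1}\le\sum_j\gamma_k^j+\sum_{i<l}\alpha_i^k$; (c) $\sum_j\beta_{k+1}^j+\sum_{i\le l}\gamma_i^{k+1}\le\sum_j\beta_k^j+\sum_{i<l}\gamma_i^k$. (4) Ballot constraints, for all $k,l$: (a) $\sum_{i<k}\alpha_l^i\ge\sum_{i\le k}\alpha_{l+1}^i$; (b) $\sum_{i<k}\beta_l^i\ge\sum_{i\le k}\beta_{l+1}^i$; (c) $\sum_{i<k}\gamma_l^i\ge\sum_{i\le k}\gamma_{l+1}^i$. *)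

(* Defs.v *)
From HB Require Import structures.
From mathcomp Require Import all_boot all_order all_algebra.
From mathcomp Require Import finmap.
From mathcomp Require Import boolp classical_sets functions cardinality fsbigop.
From mathcomp Require Import reals.
From mathcomp Require Import mpoly.

Set Implicit Arguments.
Unset Strict Implicit.
Unset Printing Implicit Defensive.

Import Order.TTheory GRing.Theory Num.Theory.

Local Open Scope classical_set_scope.
Local Open Scope ring_scope.

(* Partitions with any number of parts; zero parts are excluded so that each
   partition has exactly one representation. *)
Definition is_part (s : seq nat) : bool := sorted geq s && (0%N \notin s).

Record intpart : Type := IntPart {
  parts :> seq nat;
  _ : is_part parts
}.

HB.instance Definition _ := [isSub for parts].
HB.instance Definition _ := [Choice of intpart by <:].

Record Par (n : nat) : Type := MkPar {
  par_tuple :> n.-tuple nat;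
  par_sorted : sorted geq par_tuple
}.

Lemma strip0_is_part (n : nat) (mu : Par n) :
  is_part [seq p <- mu | p != 0%N].
Proof.
rewrite /is_part mem_filter eqxx andbT.
by apply: sorted_filter (par_sorted mu) => y x z /= xy /leq_trans; apply.
Qed.

Definition intpart_of_Par (n : nat) (mu : Par n) : intpart :=
  IntPart (strip0_is_part mu).

Definition cell (la : intpart) : finType :=
  {i : 'I_(size la) & 'I_(nth 0%N la i)}.
Definition cell_row (la : intpart) (u : cell la) : nat := tag u.
Definition cell_col (la : intpart) (u : cell la) : nat := tagged u.

Definition semistandard (la : intpart) (N : nat)
    (T : {ffun cell la -> 'I_N}) : bool :=
  [forall u : cell la, forall v : cell la,
     ((cell_row u == cell_row v) && (cell_col u < cell_col v)%N
        ==> (T u <= T v)%N)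
  && ((cell_col u == cell_col v) && (cell_row u < cell_row v)%N
        ==> (T u < T v)%N)].

(* The Schur function s_la restricted to N variables. *)
Definition schur (N : nat) (la : intpart) : {mpoly int[N]} :=
  \sum_(T : {ffun cell la -> 'I_N} | semistandard T) \prod_(u : cell la) 'X_(T u).

(* s_al s_be = \sum_ga c ga s_ga in the ring of symmetric functions: an identity
   there amounts to the same identity in N variables for every N. *)
Definition schur_product_expansion (al be : intpart) (c : intpart -> int) : Prop :=
  finite_set [set ga | c ga != 0] /\
  forall N : nat,
    schur N al * schur N be = \sum_(ga \in [set: intpart]) c ga *: schur N ga.

(* c_{al,be}^mu: the coefficient family is unique because the Schur functions
   are linearly independent; the default value 0 of xget is never used because
   they span the symmetric functions over the integers. *)
Definition LRcoef (al be mu : intpart) : int :=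
  xget (fun _ : intpart => 0) [set c | schur_product_expansion al be c] mu.

(* t.1.1, t.1.2, t.2 are alpha, beta, gamma. *)
Definition NLnumber (mu nu la : intpart) : int :=
  \sum_(t \in [set: intpart * intpart * intpart])
     LRcoef t.1.1 t.1.2 mu * LRcoef t.1.1 t.2 nu * LRcoef t.1.2 t.2 la.

(* R^(3 n^2), with coordinates grouped as (alpha, beta, gamma). *)
Notation NLspace R n := ('M[R]_n * 'M[R]_n * 'M[R]_n)%type.

Section Polytope.
Variables (R : realType) (n : nat).
Implicit Types (A B : 'M[R]_n) (p : n.-tuple nat).

(* The coordinate a_i^j is row i, column j. All indices are 0-based, and
   coordinates whose index is out of range are read as 0. *)
Definition ent A (i j : nat) : R :=
  match insub i, insub j with
  | Some i', Some j' => A i' j'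
  | _, _ => 0
  end.

Definition nonnegativity A : Prop := forall i j : 'I_n, 0 <= ent A i j.

Definition shape_constraints A B p : Prop :=
  forall k : 'I_n,
    \sum_(j < n) ent A k j + \sum_(i < n) ent B i k = (tnth p k)%:R.

Definition semistandardness_constraints A B : Prop :=
  forall k l : 'I_n,
    \sum_(j < n) ent A k.+1 j + \sum_(i < n | (i <= l)%N) ent B i k.+1
    <= \sum_(j < n) ent A k j + \sum_(i < n | (i < l)%N) ent B i k.

Definition ballot_constraints A : Prop :=
  forall k l : 'I_n,
    \sum_(i < n | (i < k)%N) ent A l i >= \sum_(i < n | (i <= k)%N) ent A l.+1 i.

Definition NLpolytope (mu nu la : Par n) : set (NLspace R n) :=
  [set x : NLspace R n | let: (al, be, ga) := x in
    [/\ [/\ nonnegativity al, nonnegativity be & nonnegativity ga],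
        [/\ shape_constraints al be mu, shape_constraints ga al nu & shape_constraints be ga la],
        [/\ semistandardness_constraints al be, semistandardness_constraints ga al
          & semistandardness_constraints be ga]
      & [/\ ballot_constraints al, ballot_constraints be & ballot_constraints ga]]].

Definition int_points : set (NLspace R n) :=
  [set x : NLspace R n | let: (al, be, ga) := x in
    forall i j : 'I_n,
      [/\ al i j \is a Num.int, be i j \is a Num.int & ga i j \is a Num.int]].

End Polytope.

Arguments NLpolytope R {n}.
Arguments int_points R n : clear implicits.

(* Main.v *)
Require Import Defs.
From mathcomp Require Import all_boot all_order all_algebra all_fingroup.
From mathcomp Require Import finmap.
From mathcomp Require Import boolp classical_sets functions cardinality fsbigop.
From mathcomp Require Import reals.
From mathcomp Require Import mpoly zify.

(** A lattice point of the polytope is a triple of matrices. Summing the rows of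
    the three matrices gives partitions al, be, ga, and each matrix records the
    row contents of a Littlewood-Richardson tableau: of shape mu/al and content
    be, of shape nu/ga and content al, of shape la/be and content ga. So the
    lattice points are counted by the sum over (al, be, ga) of the products of
    three numbers of such tableaux, and the theorem is the Littlewood-Richardson
    rule for the coefficients defined by products of Schur functions.

    The matrix whose (i, j) entry is the number of letters i in row j of a
    Littlewood-Richardson tableau of content be is also the matrix counting the
    letters j in row i of a companion tableau of shape be. The ballot constraints
    say that the companion is semistandard, and the semistandardness constraints
    say that al plus the content of any initial part of the companion, read row by
    row from the top and each row from right to left, is a partition. Such
    companions are called al-dominant here, and all arguments are about them.

    The rule follows Stembridge's argument. Tableaux are encoded as
    Gelfand-Tsetlin patterns. Reflecting every entry of one level of a pattern in
    the interval left to it by its neighbours is an involution that exchanges the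
    numbers of letters k and k+1 (bk_wtl, bk_wtr); hence Schur polynomials are
    symmetric (schur_sym), and with alt the antisymmetrization,
    alt(x^(al+rho)) s_be is the sum of alt(x^(al+wt g+rho)) over all patterns g
    of shape be. The patterns that are not al-dominant cancel in pairs
    (violation_cancel): applying the same reflection only to the part of the
    tableau that is read after the first violation of dominance exchanges two
    coordinates of al+wt g+rho (flip_wtl, flip_wtr). This proves alt_schur. For
    al = 0 only the highest weight pattern survives, so
    alt(x^rho) s_be = alt(x^(be+rho)) (alt_rho_schur), and dividing the general
    identity by alt(x^rho) expands s_al s_be over the al-dominant patterns
    (lr_rule). The coefficients of an expansion in Schur polynomials can be read
    off as the coefficients of x^(mu+rho) after multiplication by alt(x^rho)
    (expansion_uniq), which identifies LRcoef (LRcoefE). *)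

Set Implicit Arguments.
Unset Strict Implicit.
Unset Printing Implicit Defensive.

Import GRing.Theory Num.Theory.

Local Open Scope nat_scope.
Local Open Scope classical_set_scope.
Local Open Scope ring_scope.

(** * Gelfand-Tsetlin patterns *)

Local Open Scope nat_scope.

(** A tableau is encoded by the numbers g k i of letters smaller than k in row i;
    letters, rows and columns are numbered from 0. The sequence g k is called the
    level k of the pattern. *)
Definition pattern := nat -> nat -> nat.

(** Gelfand-Tsetlin patterns of shape be with letters smaller than N. The two
    inequalities say that consecutive levels interlace. All levels from N on are
    equal to be, so that a pattern with N letters is literally a pattern with
    more than N letters. *)
Definition GT (N : nat) (be : nat -> nat) (g : pattern) : Prop :=
  [/\ forall i, g 0 i = 0,
      forall k i, g k i <= g k.+1 i,
      forall k i, g k.+1 i.+1 <= g k i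
    & forall k i, N <= k -> g k i = be i].

(** Sum of the first l entries of level k. *)
Definition psum (g : pattern) (k l : nat) : nat := \sum_(i < l) g k i.
(** Number of letters k in the first l rows. *)
Definition cnt (g : pattern) (k l : nat) : nat := \sum_(i < l) (g k.+1 i - g k i).
(** Number of letters k; columns being strict, they all lie in rows 0, ..., k. *)
Definition wt (g : pattern) (k : nat) : nat := cnt g k k.+1.

Section Patterns.
Variables (N : nat) (be : nat -> nat) (g : pattern).
Hypothesis gtg : GT N be g.

Lemma GT_eq0 k i : k <= i -> g k i = 0.
Proof.
case: gtg => g0 _ gd _; elim: k i => [//|k IH] [//|i] /IH e.
by apply/eqP; rewrite -leqn0 -e gd.
Qed.

Lemma GT_mono k k' i : k <= k' -> g k i <= g k' i.
Proof.
case: gtg => _ gm _ _; elim: k' => [|k' IH]; first by rewrite leqn0 => /eqP->.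
rewrite leq_eqVlt => /predU1P[->//|/IH h]; exact: leq_trans h (gm _ _).
Qed.

(** Every level is a partition. *)
Lemma GT_row k i : g k i.+1 <= g k i.
Proof. case: gtg => _ gm gd _; exact: leq_trans (gm _ _) (gd _ _). Qed.

Lemma GT_le k i : g k i <= be i.
Proof.
case: gtg => _ _ _ gN; rewrite -(gN (maxn k N)) ?leq_maxr //.
by apply: GT_mono; rewrite leq_maxl.
Qed.

Lemma GT_shape0 i : N <= i -> be i = 0.
Proof. by case: gtg => _ _ _ gN Ni; rewrite -(gN N) // GT_eq0. Qed.

Lemma psum_stab k l : k <= l -> psum g k l = psum g k k.
Proof.
elim: l => [|l IH]; first by rewrite leqn0 => /eqP->.
rewrite leq_eqVlt => /predU1P[->//|kl].
by rewrite /psum big_ord_recr /= -/(psum g k l) IH // GT_eq0 // addn0.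
Qed.

Lemma cntE k l : cnt g k l + psum g k l = psum g k.+1 l.
Proof.
rewrite /cnt /psum -big_split /=; apply: eq_bigr => i _.
by rewrite subnK //; case: gtg.
Qed.

Lemma wtE k : wt g k + psum g k k = psum g k.+1 k.+1.
Proof. by rewrite -(cntE k k.+1) (psum_stab (leqnSn k)). Qed.

Lemma cnt_stab k l : k < l -> cnt g k l = wt g k.
Proof.
move=> kl; move: (cntE k l) (wtE k).
by rewrite (psum_stab (ltnW kl)) (psum_stab kl) => <- /addIn.
Qed.

Lemma wt_eq0 k : N <= k -> wt g k = 0.
Proof.
case: gtg => _ _ _ gN Nk; rewrite /wt /cnt big1 // => i _.
by rewrite !gN // ?subnn // leqW.
Qed.

End Patterns.

(** The ends of the interval in which interlacing with the levels k and k+2 allows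
    the entry i of level k+1 to vary. At i = l the upper end is replaced by h. The
    second bound of the usual upper end is meaningless for i = 0, but reflections
    only use i = 0 when l = 0. *)
Definition toggle_lo (g : pattern) (k i : nat) : nat := maxn (g k.+2 i.+1) (g k i).
Definition toggle_hi (g : pattern) (k l h i : nat) : nat :=
  if i == l then h else minn (g k.+2 i) (g k i.-1).

(** Reflection of the entries l, l+1, ... of level k+1 in their intervals. *)
Definition toggle (k l h : nat) (g : pattern) : pattern := fun k' i =>
  if (k' == k.+1) && (l <= i)
  then toggle_lo g k i + toggle_hi g k l h i - g k.+1 i else g k' i.

(** h lies between the entry it bounds and the largest value allowed at l. *)
Definition toggle_ok (k l h : nat) (g : pattern) : Prop :=
  [/\ g k.+1 l <= h, h <= g k.+2 l & 0 < l -> h <= g k l.-1].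

Section Toggle.
Variables (N : nat) (be : nat -> nat) (k l h : nat) (g : pattern).
Hypotheses (gtg : GT N be g) (kN : k.+1 < N) (okh : toggle_ok k l h g).

Lemma toggle_bounds i : l <= i ->
  [/\ toggle_lo g k i <= g k.+1 i, g k.+1 i <= toggle_hi g k l h i,
      toggle_hi g k l h i <= g k.+2 i & 0 < i -> toggle_hi g k l h i <= g k i.-1].
Proof.
case: okh gtg => h1 h2 h3 [g0 gm gd gN] li.
have lo : toggle_lo g k i <= g k.+1 i by rewrite /toggle_lo geq_max gd gm.
rewrite /toggle_hi; case: eqVneq => [il|il]; first by subst i.
split=> //; rewrite ?geq_minl ?geq_minr // leq_min gm /=.
by case: i li il {lo} => [|i] li il /=; [lia | exact: gd].
Qed.

Lemma toggle_row i : l <= i ->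
  toggle k l h g k.+1 i = toggle_lo g k i + toggle_hi g k l h i - g k.+1 i.
Proof. by move=> li; rewrite /toggle eqxx li. Qed.

Lemma toggle_other k' i : k' != k.+1 -> toggle k l h g k' i = g k' i.
Proof. by rewrite /toggle => /negbTE->. Qed.

Lemma toggle_lt k' i : i < l -> toggle k l h g k' i = g k' i.
Proof. by rewrite /toggle ltnNge => /negbTE->; rewrite andbF. Qed.

Lemma toggle_le_hi i : l <= i -> toggle k l h g k.+1 i <= toggle_hi g k l h i.
Proof. by move=> li; rewrite toggle_row //; case: (toggle_bounds li) => *; lia. Qed.

Lemma toggle_ge_lo i : l <= i -> toggle_lo g k i <= toggle k l h g k.+1 i.
Proof. by move=> li; rewrite toggle_row //; case: (toggle_bounds li) => *; lia. Qed.

Lemma toggle_GT : GT N be (toggle k l h g).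
Proof.
have [g0 gm gd gN] := gtg; split.
- by move=> i; rewrite toggle_other.
- move=> k' i; case: (ltnP i l) => li; first by rewrite !toggle_lt.
  have [lo1 hi1 hi2 hi3] := toggle_bounds li.
  have := toggle_le_hi li; have := toggle_ge_lo li.
  rewrite {1}/toggle_lo geq_max => /andP[_ lo2] hi4.
  case: (eqVneq k' k.+1) => [->|k1]; first by rewrite (@toggle_other k.+2); lia.
  rewrite toggle_other //; case: (eqVneq k' k) => [->//|k2].
  by rewrite toggle_other ?gm // eqSS.
- move=> k' i.
  case: (eqVneq k' k.+1) => [->|k1].
    rewrite toggle_other; last by lia.
    case: (ltnP i l) => li; first by rewrite toggle_lt.
    by have := toggle_ge_lo li; rewrite /toggle_lo geq_max => /andP[].
  rewrite (toggle_other _ k1); case: (eqVneq k' k) => [->|k2]; last first.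
    by rewrite toggle_other ?gd // eqSS.
  case: (ltnP i.+1 l) => li; first by rewrite toggle_lt.
  have [_ _ _ /(_ isT) hi3] := toggle_bounds li.
  exact: leq_trans (toggle_le_hi li) hi3.
- move=> k' i Nk'; rewrite toggle_other ?gN //; lia.
Qed.

Lemma toggle_lo_inv i : toggle_lo (toggle k l h g) k i = toggle_lo g k i.
Proof. by rewrite /toggle_lo !toggle_other //; lia. Qed.

Lemma toggle_hi_inv i : toggle_hi (toggle k l h g) k l h i = toggle_hi g k l h i.
Proof. by rewrite /toggle_hi !toggle_other //; lia. Qed.

Lemma toggleK : toggle k l h (toggle k l h g) = g.
Proof.
apply/funext => k'; apply/funext => i.
rewrite {1}/toggle; case: eqVneq => [->|k1] /=; last by rewrite toggle_other.
case: leqP => li; last by rewrite toggle_lt.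
rewrite toggle_lo_inv toggle_hi_inv toggle_row //.
by have [] := toggle_bounds li; lia.
Qed.

Lemma toggle_psum_lt k' l' : l' <= l -> psum (toggle k l h g) k' l' = psum g k' l'.
Proof.
move=> ll; apply: eq_bigr => i _; rewrite toggle_lt //.
exact: leq_trans (ltn_ord i) ll.
Qed.

Lemma toggle_psum_other k' l' : k' != k.+1 -> psum (toggle k l h g) k' l' = psum g k' l'.
Proof. by move=> k1; apply: eq_bigr => i _; rewrite toggle_other. Qed.

(** The lower end at i and the upper end at i+1 are the maximum and the minimum of
    the same two entries g k.+2 i.+1 and g k i, so their sum is the sum of these
    entries. Only the lower end at the last index and h remain unpaired. *)
Lemma toggle_psum :
  psum (toggle k l h g) k.+1 k.+1 + psum g k.+1 k.+1
    + psum g k.+2 l.+1 + psum g k l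
  = (psum g k.+1 l).*2 + h + psum g k.+2 k.+2 + psum g k k.
Proof.
have [g0 gm gd gN] := gtg.
(* The minimum is the upper end at L, not yet paired with a lower end. *)
have main L : l < L ->
  psum (toggle k l h g) k.+1 L + psum g k.+1 L + minn (g k.+2 L) (g k L.-1)
    + psum g k.+2 l.+1 + psum g k l
  = (psum g k.+1 l).*2 + h + psum g k.+2 L.+1 + psum g k L.
  elim: L => [//|L IH]; rewrite ltnS leq_eqVlt => /predU1P[<-|lL].
    have [] := toggle_bounds (leqnn l).
    rewrite /psum !big_ord_recr /= -!/(psum _ _ l) toggle_psum_lt // toggle_row //.
    rewrite /toggle_lo /toggle_hi eqxx.
    lia.
  move: (IH lL); have [] := toggle_bounds (ltnW lL).
  have e g' k' L' : psum g' k' L'.+1 = psum g' k' L' + g' k' L'.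
    by rewrite /psum big_ord_recr.
  rewrite (e g k.+2 L.+1) (e g k.+2 L) (e g k.+1 L) (e g k L) (e _ k.+1 L).
  rewrite toggle_row ?(ltnW lL) //=.
  rewrite /toggle_lo /toggle_hi.
  have -> : (L == l) = false by lia.
  lia.
have e (g' : pattern) k' L : GT N be g' -> k' <= L -> psum g' k' L = psum g' k' k'.
  by move=> gt' ?; apply: psum_stab gt' _ _ _.
(* Beyond index k+1 all the entries involved vanish. *)
pose L := maxn k.+2 l.+1.
have kL : k.+2 <= L by rewrite /L leq_maxl.
have lL : l < L by rewrite /L leq_maxr.
have := main L lL; rewrite (@GT_eq0 _ _ _ gtg k.+2 L) // min0n addn0.
rewrite (e _ k.+1 L toggle_GT) ?(e g k.+1 L gtg) ?(e g k.+2 L.+1 gtg); try lia.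
by rewrite (e g k L gtg); lia.
Qed.

Lemma toggle_wt_other j : j != k -> j != k.+1 -> wt (toggle k l h g) j = wt g j.
Proof.
move=> j1 j2; have := wtE gtg j; have := wtE toggle_GT j.
by rewrite !toggle_psum_other ?eqSS // => <- /addIn.
Qed.

Lemma toggle_wt_sum :
  wt (toggle k l h g) k + wt (toggle k l h g) k.+1 = wt g k + wt g k.+1.
Proof.
have := wtE gtg k; have := wtE toggle_GT k.
have := wtE gtg k.+1; have := wtE toggle_GT k.+1.
rewrite (@toggle_psum_other k) ?(@toggle_psum_other k.+2); lia.
Qed.

End Toggle.

Section BenderKnuth.
Variables (N : nat) (be : nat -> nat) (k : nat) (g : pattern).
Hypotheses (gtg : GT N be g) (kN : k.+1 < N).

(** The Bender-Knuth involution exchanging the numbers of letters k and k+1: all of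
    level k+1 is reflected, with the usual upper end for the entry 0. *)
Definition bk (g : pattern) : pattern := toggle k 0 (g k.+2 0) g.

Lemma bk_ok : toggle_ok k 0 (g k.+2 0) g.
Proof. by case: gtg => _ gm _ _; split. Qed.

Lemma bk_GT : GT N be (bk g).
Proof. exact: toggle_GT gtg kN bk_ok. Qed.

Lemma bkK : bk (bk g) = g.
Proof.
rewrite /bk {1}[in X in toggle _ _ X _]toggle_other; last by lia.
exact: toggleK gtg kN bk_ok.
Qed.

Lemma bk_wtl : wt (bk g) k = wt g k.+1.
Proof.
have := toggle_psum gtg kN bk_ok; have := wtE gtg k.+1; have := wtE bk_GT k.
rewrite -/(bk g) /bk toggle_psum_other; last by lia.
by rewrite /(psum g k 0) /(psum g k.+1 0) /(psum g k.+2 1) big_ord_recr !big_ord0 /=; lia.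
Qed.

Lemma bk_wtr : wt (bk g) k.+1 = wt g k.
Proof.
by have := toggle_wt_sum gtg kN bk_ok; rewrite -/(bk g) bk_wtl; lia.
Qed.

End BenderKnuth.

(** al plus the content of what is read up to the last letter k+1 of row l has
    more at k+1 than at k. The letters k of row l come after its letters k+1,
    hence the different ranges. *)
Definition violation (al : nat -> nat) (g : pattern) (k l : nat) : bool :=
  al k + cnt g k l < al k.+1 + cnt g k.+1 l.+1.

(** al plus the content of every initial part of the reading word is a partition
    (for a partition al). *)
Definition dominant (al : nat -> nat) (g : pattern) : Prop :=
  forall k l, al k.+1 + cnt g k.+1 l.+1 <= al k + cnt g k l.

(** The earliest violation in reading order: l is minimal, then k is maximal since
    rows are read from right to left. *)
Definition first_violation (al : nat -> nat) (g : pattern) (k l : nat) : Prop :=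
  [/\ violation al g k l, forall k' l', l' < l -> ~~ violation al g k' l'
    & forall k', k < k' -> ~~ violation al g k' l].

Lemma first_violation_uniq al g k l k' l' :
  first_violation al g k l -> first_violation al g k' l' -> k = k' /\ l = l'.
Proof.
move=> [b1 b2 b3] [c1 c2 c3].
have ll : l = l'.
  case: (ltngtP l l') => // h; first by rewrite (negbTE (c2 _ _ h)) in b1.
  by rewrite (negbTE (b2 _ _ h)) in c1.
subst l'; split=> //; case: (ltngtP k k') => // h.
  by rewrite (negbTE (b3 _ h)) in c1.
by rewrite (negbTE (c3 _ h)) in b1.
Qed.

Section Violation.
Variables (N : nat) (al be : nat -> nat).
Hypotheses (al_dec : forall i, al i.+1 <= al i) (al0 : forall i, N <= i -> al i = 0).

Lemma violation_lt g k l : GT N be g -> violation al g k l -> k.+1 < N.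
Proof.
move=> gtg; rewrite /violation; case: (ltnP k.+1 N) => // Nk.
have gN := let: And4 _ _ _ x := gtg in x.
rewrite (al0 Nk) add0n [X in _ < X]big1 // => i _.
by rewrite !gN // ?subnn // leqW.
Qed.

Lemma ex_first_violation g : GT N be g -> ~ dominant al g -> exists k l, first_violation al g k l.
Proof.
move=> gtg ng.
(* The letters and rows to search are bounded: from row k on, cnt g k is constant. *)
have ex : exists l, has (fun k => violation al g k l) (iota 0 N).
  case: (boolP (has (fun l => has (fun k => violation al g k l) (iota 0 N)) (iota 0 N.+2))).
    by case/hasP => l _ h; exists l.
  move/hasPn => nh; case: ng => k l; rewrite leqNgt; apply/negP => b.
  have kN := violation_lt gtg b; pose m := minn l N.+1.
  have b' : violation al g k m.
    rewrite /m; case: (leqP l N.+1) => // Nl; move: b; rewrite /violation.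
    by rewrite !(cnt_stab gtg) //; lia.
  have mN : m \in iota 0 N.+2 by rewrite mem_iota /m; lia.
  have /hasPn/(_ k) := nh _ mN; rewrite b' mem_iota add0n (ltnW kN).
  by move/(_ isT).
have [l hl lmin] := ex_minnP ex; have [k0 _ hk0] := hasP hl.
have ub k : violation al g k l -> k <= N by move/(violation_lt gtg); lia.
have [k hk kmax] := ex_maxnP (ex_intro _ k0 hk0) ub.
exists k, l; split=> // [k' l' ll|k' kk].
  apply/negP => b; have := lmin l'; rewrite leqNgt ll /= => h.
  suff : false by []; apply: h.
  by apply/hasP; exists k' => //; rewrite mem_iota /=; move/(violation_lt gtg): b; lia.
by apply/negP => /kmax; rewrite leqNgt kk.
Qed.

(** Let d be the excess of k over k+1 in al plus the content of the rows above l.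
    The first violation occurs at the (d+1)-st letter k+1 of row l from the right;
    flip_top is the number of cells of row l to the left of that letter. *)
Definition flip_top (g : pattern) k l : nat :=
  g k.+2 l - ((al k + cnt g k l) - (al k.+1 + cnt g k.+1 l)).+1.

(** The Bender-Knuth involution applied to the part of the tableau that is read
    after the first violation. *)
Definition flip k l (g : pattern) : pattern := toggle k l (flip_top g k l) g.

Section Flip.
Variables (k l : nat) (g : pattern).
Hypotheses (gtg : GT N be g) (fbg : first_violation al g k l).

Lemma cntS (g' : pattern) k' l' : cnt g' k' l'.+1 = cnt g' k' l' + (g' k'.+1 l' - g' k' l').
Proof. by rewrite /cnt big_ord_recr. Qed.

(** There is no violation for the letters k and k+1 in the row above l; for l = 0
    this says that al is nonincreasing at k. *)
Lemma first_violation_before :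
  al k.+1 + cnt g k.+1 l <= al k + cnt g k l.-1.
Proof.
case: fbg => _ h _; case: l h => [|l' h].
  by rewrite /cnt !big_ord0 !addn0.
by have := h k l' (ltnSn _); rewrite -leqNgt.
Qed.

(** The reflected interval at l respects interlacing because dominance in the row
    above makes d at least the number of letters k in that row. *)
Lemma flip_ok : toggle_ok k l (flip_top g k l) g.
Proof.
have [g0 gm gd gN] := gtg; have [b _ _] := fbg; have le := first_violation_before.
rewrite /violation cntS in b.
have le' : cnt g k l.-1 <= cnt g k l.
  by case: l => [//|l'] /=; rewrite cntS leq_addr.
rewrite /flip_top; split; [|by lia|].
  have := gm k.+1 l; lia.
case: l b le {le'} => [//|l'] /=; rewrite !cntS => b le _.
by have := gd k.+1 l'; have := gm k l'; lia.
Qed.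

Lemma flip_GT : GT N be (flip k l g).
Proof.
by have [b _ _] := fbg; exact: toggle_GT gtg (violation_lt gtg b) flip_ok.
Qed.

Lemma flip_cnt k' l' : l' <= l -> cnt (flip k l g) k' l' = cnt g k' l'.
Proof.
move=> ll; apply: eq_bigr => i _; have il : i < l := leq_trans (ltn_ord i) ll.
by rewrite /flip !toggle_lt.
Qed.

Lemma flip_top_inv : flip_top (flip k l g) k l = flip_top g k l.
Proof. by rewrite {1}/flip_top !flip_cnt // /flip toggle_other //; lia. Qed.

Lemma flipK : flip k l (flip k l g) = g.
Proof.
rewrite /flip -/(flip k l g) flip_top_inv.
by have [b _ _] := fbg; exact: toggleK gtg (violation_lt gtg b) flip_ok.
Qed.

Lemma flip_first_violation : first_violation al (flip k l g) k l.
Proof.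
have [g0 gm gd gN] := gtg; have [b1 b2 b3] := fbg; split.
- have kN := violation_lt gtg b1; have ok := flip_ok.
  have r1 : flip k l g k.+2 l = g k.+2 l by rewrite /flip toggle_other //; lia.
  have r2 : flip k l g k.+1 l <= flip_top g k l.
    by have := toggle_le_hi gtg kN ok (leqnn l); rewrite {1}/toggle_hi eqxx.
  move: b1 r2; rewrite /violation !cntS !flip_cnt // r1 /flip_top.
  by have := gm k.+1 l; lia.
- by move=> k' l' ll; rewrite /violation !flip_cnt ?(ltnW ll) //; exact: b2.
- move=> k' kk; have := b3 _ kk; rewrite /violation !cntS !flip_cnt //.
  by rewrite /flip !toggle_other //; lia.
Qed.

(** With flip_wtr: adding rho, whose entries decrease by 1, flip exchanges the
    coordinates k and k+1 of al + wt g + rho. *)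
Lemma flip_wtl : (al k + wt (flip k l g) k).+1 = al k.+1 + wt g k.+1.
Proof.
have [b _ _] := fbg; have kN := violation_lt gtg b; have le := first_violation_before.
have le' : cnt g k l.-1 <= cnt g k l.
  by case: l => [//|l'] /=; rewrite cntS leq_addr.
have := toggle_psum gtg kN flip_ok; have := wtE gtg k.+1; have := wtE flip_GT k.
have r1 : psum (flip k l g) k k = psum g k k.
  by rewrite /flip toggle_psum_other //; lia.
rewrite -/(flip k l g) r1.
have := cntE gtg k l; have := cntE gtg k.+1 l.
have -> : psum g k.+2 l.+1 = psum g k.+2 l + g k.+2 l.
  by rewrite /psum big_ord_recr.
rewrite /flip_top.
have := flip_ok; rewrite /toggle_ok /flip_top => - [ok1 _ _].
move: b ok1; rewrite /violation cntS; lia.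
Qed.

Lemma flip_wtr : al k.+1 + wt (flip k l g) k.+1 = (al k + wt g k).+1.
Proof.
have [b _ _] := fbg; have kN := violation_lt gtg b.
by have := toggle_wt_sum gtg kN flip_ok; have := flip_wtl; rewrite -/(flip k l g); lia.
Qed.

Lemma flip_wt_other j : j != k -> j != k.+1 -> wt (flip k l g) j = wt g j.
Proof.
have [b _ _] := fbg; exact: toggle_wt_other gtg (violation_lt gtg b) flip_ok _.
Qed.

End Flip.

Lemma dominant_wt g : GT N be g -> dominant al g ->
  forall k, al k.+1 + wt g k.+1 <= al k + wt g k.
Proof. by move=> gtg gg k; have := gg k k.+1. Qed.

End Violation.

(** The pattern of the tableau whose row i contains only letters i. *)
Definition g_hw (be : nat -> nat) : pattern := fun k i => if i < k then be i else 0.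

Section HighestWeight.
Variables (N : nat) (be : nat -> nat).
Hypotheses (be_dec : forall i, be i.+1 <= be i) (be0 : forall i, N <= i -> be i = 0).

Lemma hw_GT : GT N be (g_hw be).
Proof.
rewrite /g_hw; split=> [i|k i|k i|k i Nk] //.
- by case: (ltnP i k) => // ik; rewrite ltnS (ltnW ik).
- by rewrite ltnS; case: ifP.
- by case: ltnP => // ki; rewrite be0 //; apply: leq_trans ki.
Qed.

Lemma hw_cnt k l : cnt (g_hw be) k l = if k < l then be k else 0.
Proof.
elim: l => [|l IH]; first by rewrite /cnt big_ord0.
rewrite cntS IH /g_hw !ltnS.
by case: (ltngtP k l) => [||->]; rewrite ?addn0 ?subnn ?subn0.
Qed.

Lemma hw_wt k : wt (g_hw be) k = be k.
Proof. by rewrite /wt hw_cnt ltnSn. Qed.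

Lemma hw_dominant : dominant (fun=> 0) (g_hw be).
Proof. by move=> k l; rewrite !hw_cnt ltnS !add0n; case: ifP => // _. Qed.

Lemma dominant0_hw g : GT N be g -> dominant (fun=> 0) g -> g = g_hw be.
Proof.
move=> gtg gg; have [g0 gm gd gN] := gtg.
have stab l : forall k, l < k -> g k.+1 l = g k l.
  elim/ltn_ind: l => l IH [//|k] lk; have := gg k l.
  rewrite !add0n cntS [X in _ <= X]big1; last first.
    by move=> i _; rewrite IH ?subnn //; apply: leq_trans (ltn_ord i) _.
  by have := gm k.+1 l; lia.
have stab' k m l : l < k -> g (m + k) l = g k l.
  by move=> lk; elim: m => [//|m IH]; rewrite addSn stab ?IH //; lia.
apply/funext => k; apply/funext => i.
rewrite /g_hw; case: ltnP => ik; last exact: (GT_eq0 gtg ik).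
by rewrite -(stab' _ N) // gN // leq_addr.
Qed.

End HighestWeight.

(** * Tableaux as patterns *)

Lemma eq_ltP (a b : nat) : (forall c, (c < a) = (c < b)) -> a = b.
Proof.
move=> h; apply/eqP; rewrite eqn_leq leqNgt h ltnn /=.
by rewrite leqNgt -h ltnn.
Qed.

Lemma leq_ltP (a b : nat) : (forall c, c < a -> c < b) -> a <= b.
Proof. by move=> h; rewrite leqNgt; apply/negP => /h; rewrite ltnn. Qed.

(** Counting below b the elements of a predicate closed downwards gives the first
    integer that is outside the predicate or equal to b. *)
Lemma count_down (p : pred nat) b c :
  (forall c c', c <= c' -> p c' -> p c) ->
  (c < \sum_(j < b) p j) = (c < b) && p c.
Proof.
move=> pd; have full b' : p b' -> \sum_(j < b') p j = b'.
  move=> pb; rewrite -[RHS]card_ord -sum1_card; apply: eq_bigr => j _.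
  by rewrite (pd _ _ (ltnW (ltn_ord j)) pb).
elim: b => [|b IH]; first by rewrite big_ord0.
rewrite big_ord_recr /= ltnS; case: (boolP (p b)) => pb.
  rewrite full // addn1 ltnS; case: (leqP c b) => //= cb.
  by rewrite (pd _ _ cb pb).
by rewrite addn0 IH; case: (ltngtP c b) => // ->; rewrite (negbTE pb).
Qed.

(** Row lengths, extended by 0. *)
Definition sh (la : intpart) (i : nat) : nat := nth 0 la i.

Lemma sh_dec (la : intpart) i : sh la i.+1 <= sh la i.
Proof.
case: (ltnP i.+1 (size la)) => h; last by rewrite /sh nth_default.
have /andP[ss _] : is_part la by exact: (valP la).
by move/sortedP: ss => /(_ 0 i); rewrite h; apply.
Qed.

Lemma sh_gt0 (la : intpart) i : (0 < sh la i) = (i < size la).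
Proof.
case: (ltnP i (size la)) => h; last by rewrite /sh nth_default.
rewrite lt0n; apply/negP => /eqP e; have /andP[_ /negP] : is_part la by exact: (valP la).
by apply; rewrite -e mem_nth.
Qed.

Lemma sh_eq0 (la : intpart) i : size la <= i -> sh la i = 0.
Proof. by move=> h; apply/eqP; rewrite -leqn0 leqNgt sh_gt0 -leqNgt. Qed.

Section Tableaux.
Variables (la : intpart) (N : nat).
Implicit Types (T : {ffun cell la -> 'I_N}) (u v : cell la).

Lemma cell_inj u v : cell_row u = cell_row v -> cell_col u = cell_col v -> u = v.
Proof.
case: u v => [i c] [i' c']; rewrite /cell_row /cell_col /= => /val_inj e.
by subst i' => /val_inj ->.
Qed.

Lemma cell_ex i c : c < sh la i -> exists u, cell_row u = i /\ cell_col u = c.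
Proof.
move=> h; have hi : i < size la by rewrite -sh_gt0; apply: leq_ltn_trans h.
by exists (existT (fun i : 'I_(size la) => 'I_(nth 0 la i)) (Ordinal hi) (Ordinal h)).
Qed.

Lemma cell_lt u : cell_col u < sh la (cell_row u).
Proof. by case: u => i c; exact: ltn_ord. Qed.

(** The entry of T at row i and column c; the value N outside of the shape makes
    rows weakly increasing without restriction on c. *)
Definition tabval T (i c : nat) : nat :=
  if [pick u | (cell_row u == i) && (cell_col u == c)] is Some u then T u else N.

Lemma tabval_cell T u : tabval T (cell_row u) (cell_col u) = T u.
Proof.
rewrite /tabval; case: pickP => [v /andP[/eqP r /eqP c]|/(_ u)]; last by rewrite !eqxx.
by rewrite (cell_inj r c).
Qed.

(** The number of cells of row i with an entry smaller than k. *)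
Definition pattern_of T : pattern := fun k i =>
  #|[pred u : cell la | (cell_row u == i) && (T u < k)]|.

Lemma sum_row (F : nat -> nat) i :
  \sum_(u : cell la | cell_row u == i) F (cell_col u) = \sum_(c < sh la i) F c.
Proof.
have := @sig_big_dep nat 0 addn 'I_(size la) (fun i' => 'I_(nth 0 la i'))
  (fun i' => i' == i :> nat) (fun _ => xpredT) (fun i' c => F c).
rewrite /cell_row /cell_col => h.
under eq_bigl do rewrite -[_ == _]andbT.
rewrite -h; case: (ltnP i (size la)) => hi; last first.
  rewrite sh_eq0 // big_ord0 big1 // => j /eqP e.
  by have := ltn_ord j; rewrite e ltnNge hi.
by rewrite (big_pred1 (Ordinal hi)).
Qed.

Lemma pattern_ofE T k i :
  pattern_of T k i = \sum_(c < sh la i) (tabval T i c < k).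
Proof.
rewrite -(sum_row (fun c => tabval T i c < k)) /pattern_of -sum1_card big_mkcondr /=.
apply: eq_bigr => u /eqP <-; rewrite tabval_cell; by case: ifP.
Qed.

Section SemiStandard.
Variable T : {ffun cell la -> 'I_N}.
Hypothesis ssT : semistandard T.

Lemma tabval_out i c : sh la i <= c -> tabval T i c = N.
Proof.
move=> h; rewrite /tabval; case: pickP => // u /andP[/eqP e /eqP e'].
by have := cell_lt u; rewrite e e' ltnNge h.
Qed.

Lemma tabval_lt i c : c < sh la i -> tabval T i c < N.
Proof. by case/cell_ex => u [<- <-]; rewrite tabval_cell. Qed.

Lemma tabval_row i c c' : c <= c' -> tabval T i c <= tabval T i c'.
Proof.
rewrite leq_eqVlt => /predU1P[->//|cc].
case: (ltnP c' (sh la i)) => h'; last first.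
  rewrite (tabval_out h'); case: (ltnP c (sh la i)) => h; first exact/ltnW/tabval_lt.
  by rewrite tabval_out.
have [u [ui uc]] := cell_ex (ltn_trans cc h'); have [v [vi vc]] := cell_ex h'.
rewrite -[in X in X <= _]ui -uc -vi -vc !tabval_cell.
have /forallP/(_ v)/andP[/implyP h _] := forallP ssT u.
by apply: h; rewrite ui vi uc vc eqxx.
Qed.

Lemma tabval_col i c : c < sh la i.+1 -> tabval T i c < tabval T i.+1 c.
Proof.
move=> h'; have h := leq_trans h' (sh_dec la i).
have [u [ui uc]] := cell_ex h; have [v [vi vc]] := cell_ex h'.
rewrite -[in X in X < _]ui -[in X in X < _]uc -vi -vc !tabval_cell.
have /forallP/(_ v)/andP[_ /implyP ht] := forallP ssT u.
by apply: ht; rewrite ui vi uc vc eqxx ltnSn.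
Qed.

Lemma pattern_of_lt k i c :
  (c < pattern_of T k i) = (c < sh la i) && (tabval T i c < k).
Proof.
rewrite pattern_ofE (count_down (p := fun c => tabval T i c < k)) //.
by move=> c1 c2 /(tabval_row i); apply: leq_ltn_trans.
Qed.

Lemma pattern_of_GT : GT N (sh la) (pattern_of T).
Proof.
split.
- by move=> i; rewrite pattern_ofE big1.
- move=> k i; apply: leq_ltP => c; rewrite !pattern_of_lt => /andP[-> /=].
  exact: leqW.
- move=> k i; apply: leq_ltP => c; rewrite !pattern_of_lt => /andP[h1 h2].
  rewrite (leq_trans h1 (sh_dec _ _)) /=; exact: leq_trans (tabval_col h1) _.
- move=> k i Nk; apply: eq_ltP => c; rewrite pattern_of_lt.
  by case: (ltnP c _) => //= h; apply: leq_trans (tabval_lt h) Nk.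
Qed.

Lemma pattern_of_wt (k : 'I_N) : wt (pattern_of T) k = #|[pred u | T u == k]|.
Proof.
pose L := maxn k.+1 (size la).
have kL : k < L by rewrite /L leq_maxl.
rewrite -(cnt_stab pattern_of_GT kL).
transitivity (\sum_(i < L) \sum_(u : cell la) ((cell_row u == i) && (T u == k) : nat)).
  apply: eq_bigr => i _.
  have e j : pattern_of T j i = \sum_(u : cell la) ((cell_row u == i) && (T u < j)).
    by rewrite /pattern_of -sum1_card big_mkcond; apply: eq_bigr => u _; rewrite inE; case: (_ && _).
  rewrite !e; apply/eqP; rewrite -(eqn_add2r (\sum_(u : cell la) ((cell_row u == i) && (T u < k)))).
  rewrite subnK; last by apply: leq_sum => u _; case: eqP => //= _; rewrite ltnS; case: ltngtP.
  rewrite -big_split /=; apply/eqP; apply: eq_bigr => u _; case: eqP => //= _.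
  rewrite ltnS -(inj_eq val_inj) /=; by case: ltngtP.
rewrite exchange_big /= -sum1_card [RHS]big_mkcond /=; apply: eq_bigr => u _.
have uL : cell_row u < L.
  rewrite leq_max; apply/orP; right.
  by rewrite -sh_gt0; apply: leq_ltn_trans (cell_lt u).
rewrite (bigD1 (Ordinal uL)) //= eqxx big1 ?addn0 /=; first by rewrite inE; case: ifP.
move=> i; rewrite -(inj_eq val_inj) /= eq_sym => /negbTE -> //.
Qed.
End SemiStandard.

Lemma pattern_of_inj T1 T2 : semistandard T1 -> semistandard T2 ->
  pattern_of T1 = pattern_of T2 -> T1 = T2.
Proof.
move=> ss1 ss2 e; apply/ffunP => u; apply: val_inj; apply/eqP.
have lt k : (T1 u < k) = (T2 u < k).
  have := pattern_of_lt ss1 k (cell_row u) (cell_col u).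
  by rewrite e (pattern_of_lt ss2) cell_lt !tabval_cell.
by rewrite eqn_leq -[X in X && _]ltnS lt ltnSn -[X in _ && X]ltnS -lt ltnSn.
Qed.

Lemma pattern_of_surj g : GT N (sh la) g -> exists2 T, semistandard T & pattern_of T = g.
Proof.
move=> gtg; have [g0 gm gd gN] := gtg.
(* The entry at (i, c) is the number of levels among 1, ..., N that have at most
   c cells in row i. *)
pose t i c := \sum_(k < N) (g k.+1 i <= c : nat).
have tP i c k : (k < t i c) = (k < N) && (g k.+1 i <= c).
  rewrite /t (count_down (p := fun k => g k.+1 i <= c)) // => k1 k2 kk.
  by apply: leq_trans; apply: (GT_mono gtg).
have tN i c : c < sh la i -> t i c < N.
  move=> cs; rewrite ltnNge; apply/negP; case: N gtg gN tP => [|N'] gtg' gN' tP.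
    by rewrite -(gN' 0 i) // g0 in cs.
  by rewrite tP gN' // [sh la i <= c]leqNgt cs andbF.
pose T := [ffun u : cell la => Ordinal (tN _ _ (cell_lt u))].
have ssT : semistandard T.
  apply/forallP => u; apply/forallP => v; rewrite !ffunE /=; apply/andP; split.
    apply/implyP => /andP[/eqP e cc]; apply: leq_ltP => k; rewrite !tP -e.
    by move=> /andP[-> /= h]; apply: leq_trans h (ltnW cc).
  apply/implyP => /andP[/eqP e rr]; rewrite tP (tN _ _ (cell_lt u)) /= -e.
  have rg k i j : i <= j -> g k j <= g k i.
    elim: j => [|j IH]; first by rewrite leqn0 => /eqP->.
    rewrite leq_eqVlt => /predU1P[->//|/IH]; exact: leq_trans (GT_row gtg _ _).
  set k := t _ _; case: (cell_row v) rr => [//|r] rr.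
  apply: leq_trans (gd _ _) _; apply: leq_trans (rg _ (cell_row u) r rr) _.
  case ek : k => [|k']; first by rewrite g0.
  by have : k' < k; [rewrite ek | rewrite tP => /andP[]].
exists T => //; apply/funext => k; apply/funext => i; apply: eq_ltP => c.
rewrite pattern_of_lt //; case: (ltnP c (sh la i)) => /= cs; last first.
  by apply/esym/negbTE; rewrite -leqNgt (leq_trans (GT_le gtg _ _)).
have [u [ui uc]] := cell_ex cs.
rewrite -ui -uc tabval_cell ffunE /= ui uc.
case: k => [|k]; first by rewrite g0.
rewrite ltnS leqNgt tP; case: (ltnP k N) => /= kN; first by rewrite -ltnNge.
by rewrite gN ?leqW.
Qed.

Definition tableaux : seq {ffun cell la -> 'I_N} := enum (@semistandard la N).
(** An enumeration of the patterns of shape la with letters smaller than N. *)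
Definition patterns : seq pattern := [seq pattern_of T | T <- tableaux].

Lemma patterns_uniq : uniq patterns.
Proof.
rewrite map_inj_in_uniq ?enum_uniq // => T1 T2.
by rewrite !mem_enum; apply: pattern_of_inj.
Qed.

Lemma patternsP g : reflect (GT N (sh la) g) (g \in patterns).
Proof.
apply: (iffP mapP) => [[T]|/pattern_of_surj[T ssT <-]].
  by rewrite mem_enum => ssT ->; apply: pattern_of_GT.
by exists T; rewrite ?mem_enum.
Qed.

Local Open Scope ring_scope.

(** The weight of a pattern as an exponent of monomials in N variables. *)
Definition wtm (g : pattern) : 'X_{1..N} := [multinom wt g i | i < N].

Lemma schur_patterns : schur N la = \sum_(g <- patterns) 'X_[wtm g].
Proof.
rewrite /schur big_map big_enum; apply: eq_bigr => T ssT.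
rewrite mprodXE; congr ('X_[_]); apply/mnmP => k.
rewrite mnm_sumE mnmE pattern_of_wt // -sum1_card [RHS]big_mkcond /=.
by apply: eq_bigr => u _; rewrite mnm1E inE; case: (T u == k).
Qed.
End Tableaux.

Local Open Scope ring_scope.

(** * Alternants and the cancellation *)

(** The involution t is only required to preserve the part of r selected by P. *)
Lemma sum_involution (I : eqType) (V : nmodType) (r : seq I) (P : pred I)
    (F : I -> V) (t : I -> I) :
  uniq r -> (forall x, x \in r -> P x -> [/\ t x \in r, P (t x) & t (t x) = x]) ->
  \sum_(x <- r | P x) F (t x) = \sum_(x <- r | P x) F x.
Proof.
move=> ur ht; rewrite -big_filter -[RHS]big_filter -(big_map t xpredT F).
apply: perm_big; apply: uniq_perm.
- rewrite map_inj_in_uniq ?filter_uniq // => x y; rewrite !mem_filter.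
  move=> /andP[Px xr] /andP[Py yr] e.
  by have [_ _ <-] := ht x xr Px; have [_ _ <-] := ht y yr Py; rewrite e.
- exact: filter_uniq.
move=> x; rewrite mem_filter; apply/mapP/andP => [[y]|[Px xr]].
  by rewrite mem_filter => /andP[Py yr] ->; have [] := ht y yr Py.
by have [h1 h2 h3] := ht x xr Px; exists (t x); rewrite ?h3 // mem_filter h1 h2.
Qed.

Section Perm.
Variable N : nat.
(** Adjacent transpositions generate the symmetric group. *)
Lemma perm_adj_ind (P : 'S_N -> Prop) :
  P 1%g -> (forall s t, P s -> P t -> P (s * t)%g) ->
  (forall i j : 'I_N, j = i.+1 :> nat -> P (tperm i j)) -> forall s, P s.
Proof.
move=> P1 PM Padj.
have Pt d : forall i j : 'I_N, j = (i + d)%N :> nat -> P (tperm i j).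
  elim: d => [|d IH] i j e.
    by have -> : j = i by [apply: val_inj; rewrite /= e addn0]; rewrite tperm1.
  have jN : (i + d < N)%N by have := ltn_ord j; lia.
  case: d IH e jN => [|d] IH e jN; first by apply: Padj; lia.
  pose k := Ordinal jN.
  have kj : j = k.+1 :> nat by rewrite e /= addnS.
  have -> : tperm i j = (tperm k j * tperm i k * tperm k j)%g.
    rewrite -{1}[tperm k j]tpermV -mulgA -/(conjg _ _) tpermJ tpermD ?tpermL //.
      by rewrite -(inj_eq val_inj) /=; lia.
    by rewrite -(inj_eq val_inj) /=; lia.
  by apply: (PM _ _ _ (Padj _ _ kj)); apply: (PM _ _ (Padj _ _ kj)); exact: IH.
move=> s; have [ts -> _] := prod_tpermP s.
elim: ts => [|t ts IH]; first by rewrite big_nil.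
rewrite big_cons; apply: PM IH.
case: (leqP t.1 t.2) => h; first by apply: (Pt (t.2 - t.1)%N); rewrite subnKC.
by rewrite tpermC; apply: (Pt (t.1 - t.2)%N); rewrite subnKC // ltnW.
Qed.

Lemma incr_perm_id (s : 'S_N) : (forall i j : 'I_N, (i < j)%N -> (s i < s j)%N) -> s = 1%g.
Proof.
move=> incr.
have ge n : forall i : 'I_N, i = n :> nat -> (i <= s i)%N.
  elim: n => [|n IH] i e; first by rewrite e.
  have nN : (n < N)%N by have := ltn_ord i; lia.
  have := IH (Ordinal nN) erefl; have := incr (Ordinal nN) i; rewrite /= e; lia.
have le n : forall i : 'I_N, (i + n = N.-1)%N -> (s i <= i)%N.
  elim: n => [|n IH] i e; first by have := ltn_ord (s i); lia.
  have nN : (i.+1 < N)%N by lia.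
  have := IH (Ordinal nN) _; have := incr i (Ordinal nN); rewrite /=; lia.
apply/permP => i; apply: val_inj; rewrite perm1 /=; apply/eqP.
by rewrite eqn_leq (ge i) // (le (N.-1 - i)%N) //; have := ltn_ord i; lia.
Qed.
End Perm.

Section Alternant.
Variable N : nat.
Implicit Types (p q : {mpoly int[N]}) (m : 'X_{1..N}).
Local Notation "m # s" := [multinom m (s i) | i < N]
  (at level 40, left associativity, format "m # s").

(** Antisymmetrization; alt 'X_[m] is the alternant of exponent m. *)
Definition alt p : {mpoly int[N]} := \sum_(s : 'S_N) (-1) ^+ s *: msym s p.

Lemma alt_sum (I : Type) (r : seq I) (P : pred I) (F : I -> {mpoly int[N]}) :
  alt (\sum_(i <- r | P i) F i) = \sum_(i <- r | P i) alt (F i).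
Proof.
rewrite /alt [RHS]exchange_big /=; apply: eq_bigr => s _.
by rewrite (raddf_sum (msym s)) scaler_sumr.
Qed.

Lemma alt_mulsym p q : q \is symmetric -> alt (p * q) = alt p * q.
Proof.
move=> /issymP qs; rewrite mulr_suml; apply: eq_bigr => s _.
by rewrite msymM qs scalerAl.
Qed.

Lemma alt_tperm (i j : 'I_N) p : i != j -> alt (msym (tperm i j) p) = - alt p.
Proof.
move=> ij; rewrite /alt [X in _ = - X](reindex_inj (mulgI (tperm i j))) /= -sumrN.
apply: eq_bigr => s _; rewrite -msymMm odd_permM odd_tperm ij /= signrN.
by rewrite scaleNr opprK.
Qed.

Lemma alt_Xtperm (i j : 'I_N) m : i != j -> alt 'X_[m#(tperm i j)] = - alt 'X_[m].
Proof. by move=> ij; rewrite -(alt_tperm _ ij) msymX tpermV. Qed.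

(** Strictly decreasing exponents. *)
Definition strict m := forall i j : 'I_N, (i < j)%N -> (m j < m i)%N.

(** The orbit of a strictly decreasing exponent contains no other one. *)
Lemma alt_coeff m m' : strict m -> strict m' -> (alt 'X_[m])@_m' = (m == m')%:R.
Proof.
move=> sm sm'; rewrite (raddf_sum (mcoeff m')) (bigD1 1%g) //= big1.
  rewrite addr0 odd_perm1 expr0 scale1r mcoeff_sym mcoeffX.
  by congr ((m == _)%:R); apply/mnmP => i; rewrite mnmE perm1.
move=> s s1; rewrite mcoeffZ mcoeff_sym mcoeffX; case: eqP; last by rewrite mulr0.
move=> e; case/eqP: s1; apply: incr_perm_id => i j ij; have := sm i j ij.
rewrite e !mnmE; case: (ltngtP (s i) (s j)) => //.
  by move/sm' => h1 h2; lia.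
by move/val_inj => ->; rewrite ltnn.
Qed.

(** The staircase (N-1, ..., 1, 0). *)
Definition rho : 'X_{1..N} := [multinom (N - i.+1)%N | i < N].
(** The exponent formed by the first N values of a function. *)
Definition expo (f : nat -> nat) : 'X_{1..N} := [multinom f i | i < N].

Lemma strict_rho (f : nat -> nat) : (forall i, (f i.+1 <= f i)%N) -> strict (expo f + rho)%MM.
Proof.
move=> fd i j ij; rewrite !mnmDE !mnmE.
have h d : (f (i + d)%N <= f i)%N.
  by elim: d => [|d IH]; rewrite ?addn0 // addnS (leq_trans (fd _)).
have := h (j - i)%N; rewrite subnKC ?(ltnW ij) //; have := ltn_ord j; lia.
Qed.

Lemma alt_rho_neq0 : alt 'X_[rho] != 0.
Proof.
have e : rho = (expo (fun=> 0%N) + rho)%MM by apply/mnmP => i; rewrite mnmDE !mnmE.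
apply/eqP => /(congr1 (mcoeff rho)); rewrite mcoeff0 alt_coeff ?eqxx //;
  by rewrite e; apply: strict_rho.
Qed.

Lemma expo_tperm (f f' : nat -> nat) (i j : 'I_N) :
  f' i = f j -> f' j = f i -> (forall k, k != i -> k != j -> f' k = f k) ->
  expo f' = (expo f)#(tperm i j).
Proof.
move=> e1 e2 e3; apply/mnmP => k; rewrite !mnmE.
by case: tpermP => [->|->|/eqP ki /eqP kj] //; rewrite e3.
Qed.

Lemma schur_sym be : schur N be \is symmetric.
Proof.
apply/issymP; apply: perm_adj_ind => [|s t es et|i j ij].
- exact: msym1m.
- by rewrite msymMm es et.
rewrite schur_patterns (raddf_sum (msym _)) /=.
have jN : (i.+1 < N)%N by rewrite -ij.
rewrite -[RHS](sum_involution (t := bk i) _ (patterns_uniq be N)); last first.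
  move=> g /patternsP gtg _; split=> //.
    by apply/patternsP; apply: bk_GT.
  exact: bkK gtg jN.
rewrite !big_seq; apply: eq_bigr => g /patternsP gtg.
rewrite msymX tpermV; congr ('X_[_]); apply/esym; apply: expo_tperm.
- by rewrite ij (bk_wtl gtg).
- by rewrite ij (bk_wtr gtg).
- move=> k ki kj; apply: (toggle_wt_other gtg jN (bk_ok _ gtg)) => //.
  by rewrite -ij.
Qed.

Section Cancel.
Variables (al : nat -> nat) (be : intpart).
Hypotheses (al_dec : forall i, (al i.+1 <= al i)%N) (al0 : forall i, (N <= i)%N -> al i = 0%N).

(** The indices k, l of the first violation; the default value is irrelevant as
    this is only used for patterns that have one. *)
Definition violation_pos (g : pattern) : nat * nat :=
  xget (0%N, 0%N) [set p | first_violation al g p.1 p.2]%classic.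

Lemma violation_posP g : GT N (sh be) g -> ~ dominant al g ->
  first_violation al g (violation_pos g).1 (violation_pos g).2.
Proof.
move=> gtg /(ex_first_violation al0 gtg)[k [l h]].
rewrite /violation_pos; case: xgetP => [p _ //|/(_ (k, l))]; by case.
Qed.

Definition flip_violation (g : pattern) : pattern :=
  flip al (violation_pos g).1 (violation_pos g).2 g.

(** flip_violation is an involution of the patterns that are not dominant, and it
    changes the sign of their alternants. *)
Lemma violation_cancel :
  \sum_(g <- patterns be N | ~~ `[< dominant al g >]) alt 'X_[expo (fun i => al i + wt g i)%N + rho] = 0.
Proof.
set S := LHS; suff SN : S = - S.
  apply/mpolyP => m; rewrite mcoeff0; have := congr1 (mcoeff m) SN.
  rewrite mcoeffN; lia.
have nb g k l : first_violation al g k l -> ~ dominant al g.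
  by move=> [+ _ _] gg; rewrite /violation ltnNge gg.
have inv g : GT N (sh be) g -> ~ dominant al g ->
   [/\ GT N (sh be) (flip_violation g), ~ dominant al (flip_violation g) & flip_violation (flip_violation g) = g].
  move=> gtg ng; have fb := violation_posP gtg ng.
  have fb' := flip_first_violation al_dec al0 gtg fb; rewrite -/(flip_violation g) in fb'.
  have ng' := nb _ _ _ fb'.
  have gt' : GT N (sh be) (flip_violation g) by apply: flip_GT fb.
  split=> //; rewrite {1}/flip_violation.
  have [-> ->] := first_violation_uniq (violation_posP gt' ng') fb'.
  exact: (flipK al_dec al0 gtg fb).
rewrite -[LHS](sum_involution (t := flip_violation) _ (patterns_uniq be N)); last first.
  move=> g /patternsP gtg /asboolP ng; have [h1 h2 h3] := inv g gtg ng; split=> //.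
    exact/patternsP.
  exact/asboolP.
rewrite -sumrN big_seq_cond [RHS]big_seq_cond; apply: eq_bigr => g /andP[/patternsP gtg /asboolP ng].
have fb := violation_posP gtg ng; set k := (violation_pos g).1 in fb *; set l := (violation_pos g).2 in fb *.
have [b _ _] := fb; have k1N := violation_lt al0 gtg b; have kN := ltnW k1N.
rewrite -(@alt_Xtperm (Ordinal kN) (Ordinal k1N)); last first.
  by rewrite -(inj_eq val_inj) /= ltn_eqF.
congr (alt 'X_[_]).
have h1 := flip_wtl al_dec al0 gtg fb.
have h2 := flip_wtr al_dec al0 gtg fb.
have e f : (expo f + rho)%MM = expo (fun i => f i + (N - i.+1))%N.
  by apply/mnmP => i; rewrite mnmDE !mnmE.
rewrite !e; apply: expo_tperm; rewrite /= /flip_violation -/k -/l.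
- lia.
- lia.
- by move=> j jk jk1; rewrite (flip_wt_other al_dec al0 gtg fb).
Qed.

Lemma alt_schur :
  alt 'X_[expo al + rho] * schur N be =
  \sum_(g <- patterns be N | `[< dominant al g >]) alt 'X_[expo (fun i => al i + wt g i)%N + rho].
Proof.
rewrite -alt_mulsym ?schur_sym // schur_patterns mulr_sumr alt_sum.
rewrite (bigID (fun g => `[< dominant al g >])) /=.
have e g : 'X_[expo al + rho] * 'X_[wtm N g] =
   'X_[expo (fun i => al i + wt g i)%N + rho] :> {mpoly int[N]}.
  rewrite -mpolyXD; congr 'X_[_]; apply/mnmP => i.
  by rewrite !mnmDE !mnmE addnAC.
by under [X in _ + X]eq_bigr do rewrite e; rewrite violation_cancel addr0;
  under eq_bigr do rewrite e.
Qed.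

End Cancel.

Lemma alt_rho_schur (be : intpart) : (size be <= N)%N ->
  alt 'X_[rho] * schur N be = alt 'X_[expo (sh be) + rho].
Proof.
move=> sN; have e : rho = (expo (fun=> 0%N) + rho)%MM by apply/mnmP => i; rewrite mnmDE !mnmE.
rewrite {1}e alt_schur // big_seq_cond.
have hg : GT N (sh be) (g_hw (sh be)).
  by apply: hw_GT => i; [exact: sh_dec | move=> Ni; apply: sh_eq0; apply: leq_trans Ni].
rewrite (eq_bigl (pred1 (g_hw (sh be)))); last first.
  move=> g /=; apply/andP/eqP => [[/patternsP gtg /asboolP gg]|->].
    exact: (dominant0_hw gtg gg).
  by split; [apply/patternsP | apply/asboolP/hw_dominant/sh_dec].
rewrite -big_filter filter_pred1_uniq ?patterns_uniq //; last exact/patternsP.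
rewrite big_seq1; congr (alt 'X_[_]); apply/mnmP => i.
by rewrite !mnmDE !mnmE hw_wt.
Qed.

End Alternant.

(** * The Littlewood-Richardson rule *)

Local Open Scope nat_scope.

Lemma size_leP (la : intpart) N : (size la <= N) = (sh la N == 0).
Proof. by rewrite leqNgt -sh_gt0 lt0n negbK. Qed.

Lemma intpart_eq (la mu : intpart) : sh la =1 sh mu -> la = mu.
Proof.
move=> e; apply: val_inj; apply: (@eq_from_nth _ 0); last by move=> i _; exact: e.
by apply: eq_ltP => c; rewrite -!sh_gt0 e.
Qed.

Section Strip.
Variables (f : nat -> nat).
Hypothesis f_dec : forall i, f i.+1 <= f i.

Lemma dec_le i j : i <= j -> f j <= f i.
Proof.
move=> /subnKC <-; elim: (j - i) => [|d IH]; first by rewrite addn0.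
by rewrite addnS (leq_trans (f_dec _)).
Qed.

Lemma strip0_mkseq N : exists2 m, m <= N &
  [seq x <- mkseq f N | x != 0] = mkseq f m /\ forall i, m <= i < N -> f i = 0.
Proof.
elim: N => [|N [m mN [e z]]]; first by exists 0 => //; split=> // i; rewrite andbF.
rewrite mkseqS filter_rcons; case: eqVneq => /= fN.
  exists m; rewrite ?leqW //; split=> // i; rewrite ltnS [i <= N]leq_eqVlt.
  by case/andP => mi /predU1P[->//|iN]; apply: z; rewrite mi.
exists N.+1 => //; split=> [|i]; last by rewrite [i < _]ltnNge andbN.
rewrite mkseqS; congr rcons; apply/all_filterP/allP => x /mapP[i + ->].
rewrite mem_iota /= add0n => iN; rewrite -lt0n; apply: leq_trans (dec_le (ltnW iN)).
by rewrite lt0n.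
Qed.

Lemma strip0_part N : is_part [seq x <- mkseq f N | x != 0].
Proof.
rewrite /is_part mem_filter eqxx andbT; have [m _ [-> _]] := strip0_mkseq N.
apply/(sortedP 0) => i; rewrite size_mkseq => im.
by rewrite !nth_mkseq ?(ltnW im) //; exact: f_dec.
Qed.

Lemma nth_strip0 N i : nth 0 [seq x <- mkseq f N | x != 0] i = if i < N then f i else 0.
Proof.
have [m mN [-> z]] := strip0_mkseq N; case: (ltnP i m) => im.
  by rewrite nth_mkseq // (leq_trans im mN).
rewrite nth_default ?size_mkseq //; case: ltnP => // iN.
by rewrite z ?im.
Qed.

End Strip.

Definition empty_part : intpart := IntPart (isT : is_part [::]).

(** The partition with row lengths f 0, ..., f (N-1), provided that f is
    nonincreasing. *)
Definition part_of (f : nat -> nat) (N : nat) : intpart :=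
  insubd empty_part [seq x <- mkseq f N | x != 0].

Lemma sh_part_of f N i : (forall i, f i.+1 <= f i) -> (forall i, N <= i -> f i = 0) ->
  sh (part_of f N) i = f i.
Proof.
move=> fd f0; rewrite /sh /part_of insubdK ?[_ \in _]strip0_part //.
by rewrite nth_strip0 //; case: ltnP => // /f0.
Qed.

Lemma sh_intpart_of_Par n (mu : Par n) i : sh (intpart_of_Par mu) i = nth 0 mu i.
Proof.
have fd j : nth 0 mu j.+1 <= nth 0 mu j.
  case: (ltnP j.+1 (size mu)) => h; last by rewrite [X in X <= _]nth_default.
  by move/sortedP: (par_sorted mu) => /(_ 0 j h).
rewrite /sh /= -[in LHS](mkseq_nth 0 mu) size_tuple nth_strip0 //.
by case: ltnP => // h; rewrite nth_default // size_tuple.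
Qed.

(** A list that contains the partitions with at most B rows, all of length at most
    B. *)
Definition bounded_parts (B : nat) : seq intpart :=
  undup [seq part_of (fun i => if insub i is Some j then (f : {ffun 'I_B -> 'I_B.+1}) j else 0 : nat) B
        | f : {ffun 'I_B -> 'I_B.+1}].

Lemma bounded_partsP B (la : intpart) : size la <= B -> (forall i, sh la i <= B) ->
  la \in bounded_parts B.
Proof.
move=> sB hB; rewrite mem_undup; apply/mapP.
exists [ffun i : 'I_B => inord (sh la i)]; first by rewrite mem_enum.
set f := (X in part_of X); have fE i : f i = sh la i.
  rewrite /f; case: insubP => [j _ <-|]; first by rewrite ffunE inordK // ltnS.
  by rewrite -leqNgt => /(leq_trans sB)/sh_eq0.
apply: intpart_eq => i; rewrite sh_part_of ?fE // => j; rewrite !fE ?sh_dec //.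
by move=> /(leq_trans sB)/sh_eq0.
Qed.

Lemma sum_sh (la : intpart) M : \sum_(i < M) sh la i <= sumn la.
Proof.
rewrite /sh; elim: M (parts la) => [|M IH] [|x s] /=; rewrite ?big_ord0 //.
  by rewrite big1 // => i _; rewrite nth_nil.
by rewrite big_ord_recl /= leq_add2l IH.
Qed.

Lemma schur_eq0 N (la : intpart) : N < size la -> schur N la = 0%R.
Proof.
move=> h; rewrite schur_patterns; case e : (patterns la N) => [|g s]; first by rewrite big_nil.
have /patternsP/GT_shape0/(_ _ (leqnn N)) : g \in patterns la N by rewrite e inE eqxx.
by move/eqP; rewrite -size_leP leqNgt h.
Qed.

(** The al-dominant patterns g with al + wt g = mu. Those of shape be are the
    companions of the Littlewood-Richardson tableaux of shape mu/al and content
    be. *)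
Definition lr_pattern (al mu : intpart) : pred pattern := fun g =>
  `[< dominant (sh al) g /\ forall k, sh al k + wt g k = sh mu k >].

Definition lr_patterns (N : nat) (al be mu : intpart) : seq pattern :=
  [seq g <- patterns be N | lr_pattern al mu g].

Lemma lr_patternsP N al be mu g :
  reflect [/\ GT N (sh be) g, dominant (sh al) g & forall k, sh al k + wt g k = sh mu k]
    (g \in lr_patterns N al be mu).
Proof.
rewrite mem_filter; apply: (iffP andP) => [[/asboolP[gg gw] /patternsP gt]//|[gt gg gw]].
by split; [apply/asboolP | apply/patternsP].
Qed.

(** The number of these patterns. Only letters smaller than the number of rows of mu
    occur in them, so any larger bound on the letters gives the same number
    (lr_size). *)
Definition lr (al be mu : intpart) : nat := size (lr_patterns (size mu) al be mu).

Lemma lr_patterns_uniq N al be mu : uniq (lr_patterns N al be mu).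
Proof. exact: filter_uniq (patterns_uniq _ _). Qed.

Lemma wt0_stable N M be g : GT N be g -> (forall k, M <= k -> wt g k = 0) -> GT M be g.
Proof.
move=> gtg w0; have [g0 gm gd gN] := gtg; split=> //.
have st k i : M <= k -> g k.+1 i = g k i.
  move=> /w0 /eqP; rewrite -(cnt_stab gtg (leq_maxl k.+1 i.+1)) sum_nat_eq0.
  move=> /forallP/(_ (Ordinal (leq_maxr k.+1 i.+1)))/=.
  by have := gm k i; lia.
have st' d k i : M <= k -> g (d + k) i = g k i.
  by move=> Mk; elim: d => [//|d IH]; rewrite addSn st ?IH //; lia.
by move=> k i Mk; rewrite -(st' N) // gN // leq_addr.
Qed.

Lemma GT_widen N M be g : GT M be g -> M <= N -> GT N be g.
Proof. by move=> [g0 gm gd gM] MN; split=> // k i Nk; apply: gM; apply: leq_trans Nk. Qed.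

Lemma lr_size N (al be mu : intpart) : size mu <= N -> size (lr_patterns N al be mu) = lr al be mu.
Proof.
move=> sN; apply: perm_size; apply: uniq_perm; rewrite ?lr_patterns_uniq // => g.
apply/lr_patternsP/lr_patternsP => -[gt gg gw]; split=> //.
  apply: wt0_stable gt _ => k /sh_eq0; rewrite -gw; lia.
exact: GT_widen gt sN.
Qed.

Lemma lr_patterns_sub N (al be mu : intpart) g : g \in lr_patterns N al be mu ->
  forall i, sh al i <= sh mu i.
Proof. by case/lr_patternsP => _ _ gw i; rewrite -gw leq_addr. Qed.

Lemma lr_sub al be mu : 0 < lr al be mu -> forall i, sh al i <= sh mu i.
Proof.
rewrite /lr; case e : lr_patterns => [//|g s] _.
by apply: (@lr_patterns_sub (size mu) al be mu g); rewrite e inE eqxx.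
Qed.

Lemma sum_wt N be g m : GT N be g -> \sum_(k < m) wt g k = psum g m m.
Proof.
move=> gt; elim: m => [|m IH]; first by rewrite /psum !big_ord0.
by rewrite big_ord_recr /= IH addnC (wtE gt).
Qed.

(** A product of Schur functions has finitely many terms: the size of mu is the sum
    of the sizes of al and be. *)
Lemma lr_bound al be mu : 0 < lr al be mu -> mu \in bounded_parts (sumn al + sumn be).
Proof.
rewrite /lr; case e : lr_patterns => [//|g s] _.
have /lr_patternsP[gt gg gw] : g \in lr_patterns (size mu) al be mu by rewrite e inE eqxx.
set M := size mu in e gt; set B := _ + _.
have sumB : \sum_(k < M) sh mu k <= B.
  under eq_bigr do rewrite -gw; rewrite big_split /=; apply: leq_add (sum_sh _ _) _.
  suff -> : \sum_(k < M) wt g k = \sum_(i < M) sh be i by exact: sum_sh.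
  have [g0 _ _ gM] := gt.
  transitivity (psum g M M); last by apply: eq_bigr => i _; rewrite gM.
  exact: (sum_wt _ gt).
have leB k : sh mu k <= B.
  case: (ltnP k M) => kM; last by rewrite sh_eq0.
  by apply: leq_trans sumB; rewrite (bigD1 (Ordinal kM)) //= leq_addr.
apply: bounded_partsP leB; apply: leq_trans sumB.
rewrite -[X in X <= _]card_ord -sum1_card; apply: leq_sum => k _.
by rewrite sh_gt0.
Qed.

Local Open Scope ring_scope.

Section Rule.
Variables (al be : intpart).

Lemma alt_rho_mul N : (size al <= N)%N ->
  alt 'X_[rho N] * (schur N al * schur N be) =
  \sum_(g <- patterns be N | `[< dominant (sh al) g >])
     alt 'X_[expo N (fun i => sh al i + wt g i)%N + rho N].
Proof.
move=> sN; rewrite mulrA alt_rho_schur // alt_schur //; first exact: sh_dec.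
by move=> i /(leq_trans sN)/sh_eq0.
Qed.

Lemma lr_pattern_expo N g (mu : intpart) : GT N (sh be) g -> (size al <= N)%N -> (size mu <= N)%N ->
  dominant (sh al) g -> (expo N (fun i => sh al i + wt g i)%N + rho N == expo N (sh mu) + rho N)%MM
    = lr_pattern al mu g.
Proof.
move=> gt aN mN gg; apply/eqP/asboolP => [/mnmP e|[_ e]].
  split=> // k; case: (ltnP k N) => kN; last first.
    rewrite (wt_eq0 gt kN) !sh_eq0 //; exact: leq_trans kN.
  by have := e (Ordinal kN); rewrite !mnmDE !mnmE /= => /addIn.
by apply/mnmP => i; rewrite !mnmDE !mnmE e.
Qed.

(** Multiplying by alt(x^rho) turns Schur polynomials into alternants, so that the
    coefficient of x^(mu+rho) extracts the coefficient of s_mu. *)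
Lemma coeff_product N (mu : intpart) : (size al <= N)%N -> (size mu <= N)%N ->
  (alt 'X_[rho N] * (schur N al * schur N be))@_(expo N (sh mu) + rho N) = (lr al be mu)%:Z.
Proof.
move=> aN mN; rewrite alt_rho_mul // (raddf_sum (mcoeff _)) /=.
rewrite -(lr_size _ _ mN) /lr_patterns size_filter -sum1_count -[RHS]natz natr_sum.
rewrite [RHS]big_mkcond [LHS]big_mkcond /= big_seq [RHS]big_seq.
apply: eq_bigr => g /patternsP gt; case: asboolP => [gg|ng].
  rewrite alt_coeff ?lr_pattern_expo //; first by case: ifP.
    apply: strict_rho => i; exact: (dominant_wt gt gg).
  by apply: strict_rho; exact: sh_dec.
by case: ifP => // /asboolP[/ng].
Qed.

Lemma alt_rho_schur_lr N (mu : intpart) : (size al <= N)%N ->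
  alt 'X_[rho N] * ((lr al be mu)%:Z *: schur N mu) =
  \sum_(g <- patterns be N | lr_pattern al mu g)
    alt 'X_[expo N (fun i => sh al i + wt g i)%N + rho N].
Proof.
move=> aN; case: (leqP (size mu) N) => mN; last first.
  rewrite schur_eq0 // scaler0 mulr0 big_seq_cond big_pred0 // => g; apply/negP.
  move=> /andP[/patternsP gt /asboolP[gg /(_ N)]].
  rewrite (wt_eq0 gt) // sh_eq0 //; move: mN; rewrite -sh_gt0; lia.
rewrite -scalerAr alt_rho_schur // -(lr_size _ _ mN) /lr_patterns size_filter -sum1_count.
rewrite -natz natr_sum scaler_suml; apply: eq_bigr => g /asboolP[_ e].
rewrite scale1r; congr (alt 'X_[_]); apply/mnmP => i.
by rewrite !mnmDE !mnmE e.
Qed.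

Lemma lr_rule : schur_product_expansion al be (fun mu => (lr al be mu)%:Z).
Proof.
set D := bounded_parts (sumn al + sumn be).
have inD mu : (lr al be mu)%:Z != 0 -> mu \in D.
  by move=> h; apply: lr_bound; lia.
split=> [|N].
  apply: (@sub_finite_set _ _ [set` D]%classic); first by move=> mu /inD.
  exact: finite_seq.
have uD : uniq D by exact: undup_uniq.
rewrite (fsbigE D) //; last first.
  move=> mu _ /negP mD; suff -> : (lr al be mu)%:Z = 0 by rewrite scale0r.
  by apply/eqP/negPn/negP => /inD.
rewrite (eq_bigl xpredT); last by move=> mu; rewrite in_setT.
case: (leqP (size al) N) => aN; last first.
  rewrite (schur_eq0 aN) mul0r big1 // => mu _.
  case: (posnP (lr al be mu)) => [->|/lr_sub sub]; first by rewrite scale0r.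
  rewrite (schur_eq0 (la := mu)) ?scaler0 //.
  by rewrite -sh_gt0; apply: leq_trans (sub N); rewrite sh_gt0.
apply: (mulfI (alt_rho_neq0 N)).
rewrite alt_rho_mul // mulr_sumr; under [RHS]eq_bigr do rewrite alt_rho_schur_lr //.
rewrite (exchange_big_dep (fun g => `[< dominant (sh al) g >])) /=; last first.
  by move=> mu g _ /asboolP[gg _]; apply/asboolP.
rewrite big_seq_cond [RHS]big_seq_cond; apply: eq_bigr => g /andP[/patternsP gt /asboolP gg].
(* Each dominant pattern contributes to exactly one partition, al + wt g. *)
pose mu := part_of (fun i => sh al i + wt g i)%N N.
have muE k : sh mu k = (sh al k + wt g k)%N.
  rewrite sh_part_of //; first exact: (dominant_wt gt gg).
  by move=> i iN; rewrite (wt_eq0 gt iN) sh_eq0 // (leq_trans aN).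
have muD : mu \in D.
  have mN : (size mu <= N)%N.
    by rewrite size_leP muE (wt_eq0 gt) // addn0 -size_leP.
  apply: lr_bound; rewrite -(lr_size _ _ mN).
  have : g \in lr_patterns N al be mu.
    by apply/lr_patternsP; split=> // k; rewrite muE.
  by case: lr_patterns.
rewrite (eq_bigl (pred1 mu)).
  by rewrite -big_filter filter_pred1_uniq // big_seq1.
move=> mu' /=; apply/asboolP/eqP => [[_ e]|->].
  by apply: intpart_eq => k; rewrite muE e.
by split.
Qed.

Lemma expansion_uniq c : schur_product_expansion al be c ->
  forall mu, c mu = (lr al be mu)%:Z.
Proof.
move=> [fin exp] mu; pose N := maxn (size al) (size mu).
have aN : (size al <= N)%N by rewrite leq_maxl.
have mN : (size mu <= N)%N by rewrite leq_maxr.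
rewrite -(coeff_product aN mN) exp.
pose S := fset_set [set ga | c ga != 0]%classic.
have S0 ga : ga \notin S -> c ga = 0.
  by rewrite in_fset_set // => /negP h; apply/eqP/negPn/negP => h'; apply: h; rewrite inE.
rewrite (fsbigE S) ?fset_uniq //; last first.
  by move=> ga _ /S0 ->; rewrite scale0r.
rewrite (eq_bigl xpredT); last by move=> ga; rewrite in_setT.
rewrite mulr_sumr (raddf_sum (mcoeff _)) /=.
transitivity (\sum_(ga <- S) if ga == mu then c mu else 0).
  rewrite -big_mkcond /=; case: (boolP (mu \in S)) => [muS|/[dup]muS /S0 ->].
    by rewrite -big_filter filter_pred1_uniq ?fset_uniq // big_seq1.
  by rewrite big1.
apply: eq_bigr => ga _; rewrite -scalerAr mcoeffZ.
case: (leqP (size ga) N) => gN; last first.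
  rewrite schur_eq0 // mulr0 mcoeff0 mulr0; case: eqP => // e.
  by rewrite e ltnNge mN in gN.
rewrite alt_rho_schur // alt_coeff; try (apply: strict_rho; exact: sh_dec).
suff -> : (expo N (sh ga) + rho N == expo N (sh mu) + rho N)%MM = (ga == mu).
  by case: eqP => [->|]; rewrite ?mulr1 ?mulr0.
apply/eqP/eqP => [/mnmP e|->//]; apply: intpart_eq => k.
case: (ltnP k N) => kN; last by rewrite !sh_eq0 //; apply: leq_trans kN.
by have := e (Ordinal kN); rewrite !mnmDE !mnmE /= => /addIn.
Qed.

Theorem LRcoefE mu : LRcoef al be mu = (lr al be mu)%:Z.
Proof.
apply: expansion_uniq; apply: xgetPex; exists (fun mu => (lr al be mu)%:Z).
exact: lr_rule.
Qed.

End Rule.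

(** * Lattice points of the polytope *)

Local Open Scope nat_scope.

Lemma LRcoefC al be mu : LRcoef al be mu = LRcoef be al mu.
Proof.
rewrite /LRcoef; congr (xget _ _ mu); apply/funext => c; apply/propext.
by split=> -[fin h]; split=> // N; rewrite mulrC h.
Qed.

Lemma pattern_tele N be g k i : GT N be g -> \sum_(j < k) (g j.+1 i - g j i) = g k i.
Proof.
move=> [g0 gm _ _]; elim: k => [|k IH]; first by rewrite big_ord0 g0.
by rewrite big_ord_recr /= IH subnKC.
Qed.

(** For patterns with n letters and n rows, the inequalities with indices smaller
    than n imply all others. *)
Lemma dominant_bounded n al be g : (forall i, n <= i -> al i = 0) -> GT n be g ->
  (forall k l, k < n -> l < n -> al k.+1 + cnt g k.+1 l.+1 <= al k + cnt g k l) ->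
  dominant al g.
Proof.
move=> al0 gt h k l; rewrite leqNgt; apply/negP => b.
have kn := violation_lt al0 gt b; case: (ltnP l n) => ln.
  by move: b; rewrite ltnNge h // ltnW.
have := h k n.-1; move: b; rewrite !(cnt_stab gt); lia.
Qed.

Local Open Scope ring_scope.

Section Matrices.
Variables (R : realType) (n : nat).
Implicit Types (A B : 'M[R]_n).

(** The matrix with entry (i, j) the number of letters j in row i of the tableau
    encoded by g. *)
Definition mx_of (g : pattern) : 'M[R]_n := \matrix_(i, j) (g j.+1 i - g j i)%N%:R.

Lemma ent_in A (i j : 'I_n) : ent A i j = A i j.
Proof. by rewrite /ent !valK. Qed.

Lemma ent_out A (i j : nat) : (n <= i)%N || (n <= j)%N -> ent A i j = 0.
Proof.
rewrite /ent; case: insubP => [i' i_n _|//]; case: insubP => [j' j_n _|//].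
by rewrite leqNgt i_n leqNgt j_n.
Qed.

Section OnePattern.
Variables (be : nat -> nat) (g : pattern).
Hypothesis gt : GT n be g.

Lemma ent_mx i j : ent (mx_of g) i j = (g j.+1 i - g j i)%N%:R.
Proof.
have [g0 gm gd gN] := gt.
case: (ltnP i n) => i_n; last first.
  have z k : g k i = 0%N by apply/eqP; rewrite -leqn0 -(GT_shape0 gt i_n) (GT_le gt).
  by rewrite ent_out ?i_n // !z.
case: (ltnP j n) => j_n; last by rewrite ent_out ?j_n ?orbT // !gN ?subnn ?leqW.
by rewrite (ent_in _ (Ordinal i_n) (Ordinal j_n)) mxE.
Qed.

Lemma mx_row_lt (k i : nat) : (k <= n)%N ->
  \sum_(j < n | (j < k)%N) ent (mx_of g) i j = (g k i)%:R.
Proof.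
move=> kn; rewrite -(big_ord_widen n (fun j => ent (mx_of g) i j)) //.
under eq_bigr do rewrite ent_mx.
by rewrite -natr_sum (pattern_tele _ _ gt).
Qed.

Lemma mx_row (i : nat) : \sum_(j < n) ent (mx_of g) i j = (be i)%:R.
Proof.
have [_ _ _ gN] := gt; rewrite -(gN n) // -mx_row_lt //.
by apply: eq_bigl => j; rewrite ltn_ord.
Qed.

Lemma mx_col_lt (k l : nat) : (l <= n)%N ->
  \sum_(i < n | (i < l)%N) ent (mx_of g) i k = (cnt g k l)%:R.
Proof.
move=> ln; rewrite -(big_ord_widen n (fun i => ent (mx_of g) i k)) //.
by under eq_bigr do rewrite ent_mx; rewrite -natr_sum.
Qed.

Lemma mx_col (k : 'I_n) : \sum_(i < n) ent (mx_of g) i k = (wt g k)%:R.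
Proof.
rewrite -(cnt_stab gt (ltn_ord k)) -mx_col_lt //.
by apply: eq_bigl => j; rewrite ltn_ord.
Qed.

Lemma mx_nonneg : nonnegativity (mx_of g).
Proof. by move=> i j; rewrite ent_mx ler0n. Qed.

Lemma mx_int (i j : 'I_n) : mx_of g i j \is a Num.int.
Proof. by rewrite mxE; apply: intr_nat; apply: natr_nat. Qed.

Lemma mx_ballot : ballot_constraints (mx_of g).
Proof.
have [_ _ gd _] := gt; move=> k l.
rewrite mx_row_lt ?(ltnW (ltn_ord k)) // (mx_row_lt (k := k.+1)) //.
by rewrite ler_nat.
Qed.

End OnePattern.

Lemma mx_inj be be' g g' : GT n be g -> GT n be' g' -> mx_of g = mx_of g' -> g = g'.
Proof.
move=> gt gt' e; apply/funext => k; apply/funext => i.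
rewrite -(pattern_tele _ _ gt) -(pattern_tele _ _ gt'); apply: eq_bigr => j _.
by apply/eqP; rewrite -(eqr_nat R) -(ent_mx gt) -(ent_mx gt') e.
Qed.

(** The ballot constraints are the interlacing inequalities, so they characterize
    the integral matrices that come from patterns. *)
Lemma mx_of_ballot A : nonnegativity A -> (forall i j, A i j \is a Num.int) ->
  ballot_constraints A -> exists be g, GT n be g /\ mx_of g = A.
Proof.
move=> nn int bal.
have /choice[a aE] : forall p : nat * nat, exists m : nat, ent A p.1 p.2 = m%:R.
  move=> [i j] /=; case: (ltnP i n) => i_n; last by exists 0%N; rewrite ent_out // i_n.
  case: (ltnP j n) => j_n; last by exists 0%N; rewrite ent_out // j_n orbT.
  apply/natrP; rewrite natrEint (nn (Ordinal i_n) (Ordinal j_n)) andbT.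
  by rewrite (ent_in A (Ordinal i_n) (Ordinal j_n)).
have a0 i j : (n <= i)%N || (n <= j)%N -> a (i, j) = 0%N.
  by move=> h; apply/eqP; rewrite -(eqr_nat R) -aE ent_out.
pose g : pattern := fun k i => (\sum_(j < k) a (i, nat_of_ord j))%N.
have gS k i : g k.+1 i = (g k i + a (i, k))%N by rewrite /g big_ord_recr.
have gN d i : g (n + d)%N i = g n i.
  by elim: d => [|d IH]; rewrite ?addn0 // addnS gS IH a0 ?addn0 // leq_addr orbT.
have gsum k i : (k <= n)%N -> \sum_(j < n | (j < k)%N) ent A i j = (g k i)%:R.
  move=> kn; rewrite -(big_ord_widen n (fun j => ent A i j)) // natr_sum.
  by apply: eq_bigr => j _; rewrite -aE.
have gz k i : (n <= i)%N -> g k i = 0%N by move=> h; rewrite /g big1 // => j _; rewrite a0 ?h.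
have gb k l : (k < n)%N -> (g k.+1 l.+1 <= g k l)%N.
  move=> kn; case: (ltnP l n) => ln; last by rewrite gz // leqW.
  have := bal (Ordinal kn) (Ordinal ln); rewrite gsum ?(ltnW kn) //.
  by rewrite (gsum k.+1) // ler_nat.
exists (g n), g; split; last first.
  apply/matrixP => i j; rewrite mxE gS addKn.
  by rewrite -(ent_in A) (aE (val i, val j)).
split.
- by move=> i; rewrite /g big_ord0.
- by move=> k i; rewrite gS leq_addr.
- move=> k l; case: (ltnP k n) => kn; first exact: gb.
  have -> : g k.+1 l.+1 = g n l.+1 by rewrite -(gN (k.+1 - n)%N) subnKC // leqW.
  have -> : g k l = g n l by rewrite -(gN (k - n)%N) subnKC.
  case: n gb => [|m] gb'; first by rewrite /g !big_ord0.
  by apply: leq_trans (gb' m l _) _; rewrite // gS leq_addr.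
- by move=> k i /subnKC <-; rewrite gN.
Qed.

Lemma mx_shape a ga b gb (p : n.-tuple nat) : GT n a ga -> GT n b gb ->
  shape_constraints (mx_of ga) (mx_of gb) p <->
  forall k, (k < n)%N -> (a k + wt gb k)%N = nth 0%N p k.
Proof.
move=> gta gtb; split=> h k => [kn|].
  have := h (Ordinal kn); rewrite (mx_row gta) (mx_col gtb) -natrD (tnth_nth 0%N) /=.
  by move/eqP; rewrite eqr_nat => /eqP.
by rewrite (mx_row gta) (mx_col gtb) -natrD h // (tnth_nth 0%N).
Qed.

Lemma mx_semistandard a ga b gb : GT n a ga -> GT n b gb ->
  semistandardness_constraints (mx_of ga) (mx_of gb) <-> dominant a gb.
Proof.
move=> gta gtb; split=> [h|h k l].
  apply: (dominant_bounded (GT_shape0 gta) gtb) => k l kn ln.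
  have := h (Ordinal kn) (Ordinal ln); rewrite !(mx_row gta) /=.
  rewrite (mx_col_lt gtb _ (ltnW ln)) (mx_col_lt gtb _ (l := l.+1) ln).
  by rewrite -!natrD ler_nat.
rewrite !(mx_row gta) (mx_col_lt gtb _ (ltnW (ltn_ord l))) (mx_col_lt gtb _ (ltn_ord l)).
by rewrite -!natrD ler_nat.
Qed.

End Matrices.

Section Count.
Variables (R : realType) (n : nat) (mu nu la : Par n).

Let IP := @intpart_of_Par n.
Let L : set (NLspace R n) := (NLpolytope R mu nu la `&` int_points R n)%classic.

Lemma size_intpart_of_Par (p : Par n) : (size (IP p) <= n)%N.
Proof. by rewrite size_leP sh_intpart_of_Par nth_default // size_tuple. Qed.

(** Triples (al, be, ga), resp. of patterns with shapes al, be, ga; declared as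
    choice types for the sake of inference. *)
Definition NLtriple : choiceType := (intpart * intpart * intpart)%type.
Definition NLpatterns : choiceType := (pattern * pattern * pattern)%type.

(** The triples of patterns counted by the summand of the Newell-Littlewood number
    at t = (al, be, ga). The pattern of shape al is ga-dominant of weight nu - ga,
    the one of shape be is al-dominant of weight mu - al, and the one of shape ga
    is be-dominant of weight la - be. *)
Definition NLfiber (t : NLtriple) : seq NLpatterns :=
  [seq (p, gc) |
    p <- [seq (ga, gb) | ga <- lr_patterns n t.2 t.1.1 (IP nu),
                         gb <- lr_patterns n t.1.1 t.1.2 (IP mu)],
    gc <- lr_patterns n t.1.2 t.2 (IP la)].

Lemma NLfiberP t ga gb gc :
  reflect [/\ ga \in lr_patterns n t.2 t.1.1 (IP nu), gb \in lr_patterns n t.1.1 t.1.2 (IP mu)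
            & gc \in lr_patterns n t.1.2 t.2 (IP la)] ((ga, gb, gc) \in NLfiber t).
Proof.
apply: (iffP allpairsP) => [[[p c] /= [/allpairsP[[a b] /= [ha hb ->]] hc [-> -> ->]]] //|].
move=> [ha hb hc]; exists ((ga, gb), gc); split=> //=.
by apply/allpairsP; exists (ga, gb).
Qed.

Lemma NLfiber_uniq t : uniq (NLfiber t).
Proof.
apply: allpairs_uniq; rewrite ?lr_patterns_uniq //; last by case=> [? ?] [? ?] _ _.
by apply: allpairs_uniq; rewrite ?lr_patterns_uniq //; case=> [? ?] [? ?] _ _.
Qed.

Lemma size_NLfiber (t : NLtriple) : (size (NLfiber t))%:Z =
  LRcoef t.1.1 t.1.2 (IP mu) * LRcoef t.1.1 t.2 (IP nu) * LRcoef t.1.2 t.2 (IP la).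
Proof.
rewrite (LRcoefC t.1.1 t.2) !LRcoefE !size_allpairs.
rewrite !lr_size ?size_intpart_of_Par //; lia.
Qed.

Definition point (p : NLpatterns) : NLspace R n :=
  (mx_of R n p.1.1, mx_of R n p.1.2, mx_of R n p.2).

Lemma shape_lr a ga (al be : intpart) g (p : Par n) : GT n a ga -> sh al =1 a ->
  GT n (sh be) g ->
  (shape_constraints (mx_of R n ga) (mx_of R n g) p /\
   semistandardness_constraints (mx_of R n ga) (mx_of R n g)) <->
  g \in lr_patterns n al be (IP p).
Proof.
move=> gta /funext e gt; rewrite (mx_shape _ _ gta gt) (mx_semistandard _ gta gt) -e.
split=> [[hs hg]|/lr_patternsP[_ hg hs]]; last first.
  by split=> // k _; rewrite hs sh_intpart_of_Par.
apply/lr_patternsP; split=> // k; rewrite sh_intpart_of_Par.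
case: (ltnP k n) => kn; first exact: hs.
by rewrite e (GT_shape0 gta) // (wt_eq0 gt) // nth_default // size_tuple.
Qed.

Lemma point_in_polytope t p : p \in NLfiber t -> L (point p).
Proof.
case: t p => [[al be] ga] [[pa pb] pc] /NLfiberP /= [ha hb hc].
have /lr_patternsP[gta _ _] := ha; have /lr_patternsP[gtb _ _] := hb.
have /lr_patternsP[gtc _ _] := hc.
have [[s1 t1] [s2 t2] [s3 t3]] :
  [/\ shape_constraints (mx_of R n pa) (mx_of R n pb) mu /\
      semistandardness_constraints (mx_of R n pa) (mx_of R n pb),
      shape_constraints (mx_of R n pc) (mx_of R n pa) nu /\
      semistandardness_constraints (mx_of R n pc) (mx_of R n pa)
    & shape_constraints (mx_of R n pb) (mx_of R n pc) la /\
      semistandardness_constraints (mx_of R n pb) (mx_of R n pc)].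
  by split; [apply/(shape_lr _ gta _ gtb) | apply/(shape_lr _ gtc _ gta)
            | apply/(shape_lr _ gtb _ gtc)].
split; last by move=> i j /=; split; apply: mx_int.
split; split=> //; [exact: (mx_nonneg R gta)|exact: (mx_nonneg R gtb)|exact: (mx_nonneg R gtc)
 |exact: (mx_ballot R gta)|exact: (mx_ballot R gtb)|exact: (mx_ballot R gtc)].
Qed.

Lemma GT_part be g : GT n be g -> sh (part_of be n) =1 be.
Proof.
move=> gt i; apply: sh_part_of => [j|j jn]; last exact: (GT_shape0 gt jn).
by have [_ _ _ gN] := gt; rewrite -!(gN n) // (GT_row gt).
Qed.

Lemma polytope_point x : L x -> exists t p, p \in NLfiber t /\ x = point p.
Proof.
case: x => [[A B] C] [/= [[nA nB nC] [sa sb sc] [ta tb tc] [bA bB bC]] int].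
have [a [pa [gta ea]]] := mx_of_ballot nA (fun i j => let: And3 h _ _ := int i j in h) bA.
have [b [pb [gtb eb]]] := mx_of_ballot nB (fun i j => let: And3 _ h _ := int i j in h) bB.
have [c [pc [gtc ec]]] := mx_of_ballot nC (fun i j => let: And3 _ _ h := int i j in h) bC.
have GT' (f : nat -> nat) g : GT n f g -> GT n (sh (part_of f n)) g.
  by move=> gt; have /funext -> := GT_part gt.
exists (part_of a n, part_of b n, part_of c n), (pa, pb, pc).
split; last by rewrite /point /= ea eb ec.
rewrite -ea -eb -ec in sa sb sc ta tb tc.
apply/NLfiberP; split=> /=.
- by apply/(shape_lr _ gtc (GT_part gtc) (GT' _ _ gta)).
- by apply/(shape_lr _ gta (GT_part gta) (GT' _ _ gtb)).
- by apply/(shape_lr _ gtb (GT_part gtb) (GT' _ _ gtc)).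
Qed.

(** A list that contains the partitions whose diagram is included in that of mu. *)
Definition subparts (mu : intpart) : seq intpart := bounded_parts (size mu + sh mu 0).

Lemma subpartsP (al be : intpart) : (forall i, sh al i <= sh be i)%N -> al \in subparts be.
Proof.
move=> sub; apply: bounded_partsP => [|i].
  rewrite size_leP -leqn0 (leq_trans (sub _)) // sh_eq0 //; lia.
by rewrite (leq_trans (sub i)) // (leq_trans (dec_le (sh_dec be) (leq0n i))) // leq_addl.
Qed.

(** A finite list of triples outside of which NLfiber is empty. *)
Definition NLtriples : seq NLtriple :=
  [seq (p, ga) | p <- [seq (al, be) | al <- subparts (IP mu), be <- subparts (IP la)],
                 ga <- subparts (IP nu)].

Lemma NLtriples_uniq : uniq NLtriples.
Proof.
apply: allpairs_uniq; rewrite ?undup_uniq //; last by case=> [? ?] [? ?] _ _.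
by apply: allpairs_uniq; rewrite ?undup_uniq //; case=> [? ?] [? ?] _ _.
Qed.

Lemma NLfiber_triple t p : p \in NLfiber t -> t \in NLtriples.
Proof.
case: t p => [[al be] ga] [[pa pb] pc] /NLfiberP /= [ha hb hc].
apply/allpairsP; exists ((al, be), ga); split=> //=; last exact: subpartsP (lr_patterns_sub ha).
apply/allpairsP; exists (al, be); split=> //=; apply: subpartsP.
  exact: lr_patterns_sub hb.
exact: lr_patterns_sub hc.
Qed.

Lemma fiber_point_inj t t' p p' : p \in NLfiber t -> p' \in NLfiber t' ->
  point p = point p' -> t = t' /\ p = p'.
Proof.
case: t t' p p' => [[al be] ga] [[al' be'] ga'] [[pa pb] pc] [[pa' pb'] pc'].
move=> /NLfiberP /= [/lr_patternsP[ha _ _] /lr_patternsP[hb _ _] /lr_patternsP[hc _ _]].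
move=> /NLfiberP /= [/lr_patternsP[ha' _ _] /lr_patternsP[hb' _ _] /lr_patternsP[hc' _ _]].
move=> [/(mx_inj ha ha') ea /(mx_inj hb hb') eb /(mx_inj hc hc') ec].
have sh_eq (x y : intpart) g : GT n (sh x) g -> GT n (sh y) g -> x = y.
  by move=> [_ _ _ h] [_ _ _ h']; apply: intpart_eq => i; rewrite -(h n) // -(h' n).
rewrite -ea in ha'; rewrite -eb in hb'; rewrite -ec in hc'.
by rewrite (sh_eq _ _ _ ha ha') (sh_eq _ _ _ hb hb') (sh_eq _ _ _ hc hc') ea eb ec.
Qed.

(** The list of the lattice points, grouped by the partitions (al, be, ga) that
    their row sums form. *)
Definition lattice_points : seq (NLspace R n) :=
  [seq point p | t <- NLtriples, p <- NLfiber t].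

Lemma lattice_points_uniq : uniq lattice_points.
Proof.
apply: allpairs_uniq_dep.
- exact: NLtriples_uniq.
- by move=> t _; exact: NLfiber_uniq.
move=> [t p] [t' p'] /allpairsPdep[t1 [p1 [_ h1 [e1 e1']]]].
move=> /allpairsPdep[t2 [p2 [_ h2 [e2 e2']]]] /=.
move=> e; subst t1 p1 t2 p2.
by have [-> ->] := fiber_point_inj h1 h2 e.
Qed.

Lemma lattice_pointsE : L = [set` lattice_points]%classic.
Proof.
apply/seteqP; split=> x /=.
  move=> /polytope_point[t [p [ht ->]]]; apply/allpairsPdep; exists t, p.
  by split=> //; exact: NLfiber_triple ht.
by move=> /allpairsPdep[t [p [_ hp ->]]]; exact: point_in_polytope hp.
Qed.

Lemma NLnumberE : NLnumber (IP mu) (IP nu) (IP la) = (size lattice_points)%:Z.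
Proof.
rewrite /NLnumber (fsbigE NLtriples) ?NLtriples_uniq //; last first.
  move=> t _; rewrite -size_NLfiber; case e : (NLfiber t) => [|p s] //.
  have /NLfiber_triple -> // : p \in NLfiber t by rewrite e inE eqxx.
rewrite (eq_bigl xpredT); last by move=> t; rewrite in_setT.
rewrite size_allpairs_dep sumnE big_map -[RHS]natz natr_sum.
by apply: eq_bigr => t _; rewrite -size_NLfiber natz.
Qed.

End Count.

Local Open Scope classical_set_scope.
Local Open Scope ring_scope.

Theorem theorem5p1 (R : realType) (n : nat) (hn : (1 <= n)%N)
    (mu nu la : Par n) :
  let L : set (NLspace R n) := NLpolytope R mu nu la `&` int_points R n in
  finite_set L /\
  NLnumber (intpart_of_Par mu) (intpart_of_Par nu) (intpart_of_Par la)
    = #|` fset_set L|%fset%:Z.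
Proof.
rewrite /= lattice_pointsE; split; first exact: finite_seq.
rewrite (NLnumberE R); congr (_%:Z).
have -> : [set` lattice_points R mu nu la] =
          [set` [fset x in lattice_points R mu nu la]%fset].
  by apply/seteqP; split=> x /=; rewrite inE.
by rewrite set_fsetK card_fseq undup_id // lattice_points_uniq.
Qed.
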